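(* Let $\phi_d:\mathcal X\times\mathcal Y\to\mathbb R^d$ be an embedding. Suppose $\tilde p_{\phi_d}(x,y,y')\in(0,1)$ almost surely and define $\kappa_d(x,y,y')=\tilde p_{\phi_d}(x,y,y')\bigl(1-\tilde p_{\phi_d}(x,y,y')\bigr)$. Define $\nu_{d,x}$ as the pushforward of $\mu_x$ under $\phi_d(x,\cdot)$ and $\nu_{d,x}^{\otimes2}=\nu_{d,x}\otimes\nu_{d,x}$. Define the score function $W_d(x,y,y')=F^{-1}(\tilde p_{\phi_d}(x,y,y'))$ and the subspace $$\mathcal V_x=\overline{\bigl\{\Delta h:\ h:\mathcal Z_d(x)\to\mathbb R\bigr\}}^{\,L^2(\nu_{d,x}^{\otimes2})},\qquad(\Delta h)(z,z')=h(z)-h(z'),$$ let $\Pi_{\mathcal V_x}$ denote orthogonal projection onto $\mathcal V_x\subseteq L^2(\nu_{d,x}^{\otimes2})$, and set $$U_x=\widetilde W_{d,x}-\Pi_{\mathcal V_x}\widetilde W_{d,x},\qquad \widetilde W_{d,x}(z,z')=W_d(x,y,y')\ \text{ where } z=\phi_d(x,y),\ z'=\phi_d(x,y').$$ Then for every $\varepsilon>0$ there exists a measurable prompt-indexed score head $g_x^\varepsilon:\mathbb R^d\to\mathbb R$ such that $r_d^\varepsilon(x,y)=g_x^\varepsilon(\phi_d(x,y))$ satisfies $$\mathcal L(r_d^\varepsilon)-\mathcal L^\ast\ \le\ \mathbb E\left[\frac{(\bar p-\tilde p_{\phi_d})^2}{\kappa_d}\right]+\frac18\,\mathbb E_{x}\bigl[\|U_x\|_{L^2(\nu_{d,x}^{\otimes2})}^2\bigr]+\varepsilon,$$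 where the first expectation is over $x\sim\nu$, $(y,y')\sim\mu_x^{\otimes2}$, and the second is over $x\sim\nu$.
   Context: $\mathcal X$ is the prompt space and $\mathcal Y$ the response space; $\nu$ is a probability distribution on $\mathcal X$ and, for each $x\in\mathcal X$, $\mu_x$ is a probability distribution on $\mathcal Y$. There are $n$ annotators with utilities $u_i:\mathcal X\times\mathcal Y\to\mathbb R$, $i=1,\dots,n$. Let $F(t)=1/(1+e^{-t})$, and let the pooled win probability be $\bar p(x,y,y')=\frac1n\sum_{i=1}^nF(u_i(x,y)-u_i(x,y'))$. The embedding-induced win probability is $\tilde p_{\phi_d}(x,y,y')=\mathbb E_{(y_0,y_0')\sim\mu_x^{\otimes2}}[\bar p(x,y_0,y_0')\mid\phi_d(x,y_0)=\phi_d(x,y),\ \phi_d(x,y_0')=\phi_d(x,y')]$. It depends on $(y,y')$ only through $(\phi_d(x,y),\phi_d(x,y'))$, so $\widetilde W_{d,x}$ is well defined. $\mathcal Z_d(x)=\phi_d(x,\mathcal Y)$ is the set of embedded values at prompt $x$. For a reward $r:\mathcal X\times\mathcal Y\to\mathbb R$, $\Delta r(x,y,y')=r(x,y)-r(x,y')$ and the loss is $\mathcal L(r)=\mathbb E_{x\sim\nu}\mathbb E_{(y,y')\sim\mu_x^{\otimes2}}[-\bar p\log F(\Delta r)-(1-\bar p)\log(1-F(\Delta r))]$, with $\bar p$ and $\Delta r$ evaluated at $(x,y,y')$. The Bayes-optimal loss is $\mathcal L^\ast=\mathbb E_{x\sim\nu}\mathbb E_{(y,y')\sim\mu_x^{\otimes2}}[-\bar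 p\log\bar p-(1-\bar p)\log(1-\bar p)]$. *)

(* Defs.v *)
From HB Require Import structures.
From mathcomp Require Import all_boot all_order all_algebra.
From mathcomp Require Import all_classical all_reals all_analysis.
From mathcomp Require Import measurable_realfun.

Set Implicit Arguments.
Unset Strict Implicit.
Unset Printing Implicit Defensive.

Import Order.TTheory GRing.Theory Num.Theory.
Import numFieldNormedType.Exports.

Local Open Scope classical_set_scope.
Local Open Scope ring_scope.

Section Sigmoid.
Context {R : realType}.

Definition sigmoid (t : R) : R := 1 / (1 + expR (- t)).

Definition logit (p : R) : R := ln (p / (1 - p)).

(* logit is the inverse of sigmoid : R -> (0, 1). *)
Lemma sigmoidK : cancel sigmoid logit.
Proof.
move=> t; rewrite /logit /sigmoid.
have e0 : 0 < expR (- t) := expR_gt0 _.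
have d0 : 1 + expR (- t) != 0 by rewrite gt_eqF// addr_gt0.
have -> : 1 - 1 / (1 + expR (- t)) = expR (- t) / (1 + expR (- t)).
  by apply: (mulIf d0); rewrite mulrBl !divfK// mul1r addrAC subrr add0r.
rewrite invf_div mulrA divfK// div1r expRN invrK.
exact: expRK.
Qed.

Lemma logitK p : 0 < p < 1 -> sigmoid (logit p) = p.
Proof.
move=> /andP[p0 p1]; rewrite /logit /sigmoid.
have q0 : 0 < 1 - p by rewrite subr_gt0.
rewrite expRN lnK ?posrE ?divr_gt0// invf_div.
have -> : 1 + (1 - p) / p = p^-1.
  by apply: (mulIf (lt0r_neq0 p0)); rewrite mulrDl divfK ?gt_eqF// mulVf ?gt_eqF//
    mul1r addrC subrK.
by rewrite div1r invrK.
Qed.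

End Sigmoid.

Section ConditionalExpectation.
Context {R : realType} {d1 d2 : measure_display}.
Context {Om : measurableType d1} {T : measurableType d2}.

(* q t is a version of E_P[f | S = t]; q is only determined almost everywhere
   for the law of S. *)
Definition is_cond_expectation (P : {measure set Om -> \bar R}) (S : Om -> T)
    (f : Om -> R) (q : T -> R) : Prop :=
  [/\ measurable_fun [set: T] q,
      P.-integrable [set: Om] (fun w => (q (S w))%:E) &
      forall B, measurable B ->
        (\int[P]_(w in S @^-1` B) (q (S w))%:E =
         \int[P]_(w in S @^-1` B) (f w)%:E)%E].

End ConditionalExpectation.

Section L2.
Context {R : realType} {d0 : measure_display} {T : measurableType d0}.
Variable m : {measure set T -> \bar R}.

Definition L2_closure (A : set (T -> R)) : set (T -> R) :=
  [set v | v \in Lfun m 2%:E /\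
    forall e : R, 0 < e ->
      exists2 a, A a & ('N[m]_(2%:E)[EFin \o (v \- a)%R] < e%:E)%E].

(* The residual w - v is orthogonal to V.  L^2 classes are handled through
   representatives, so the projection is one of its representatives.  If w is
   measurable but not in L^2, the value is some v which is in V or 0, so
   w - v is not in L^2 either and its norm is +oo. *)
Definition L2_proj (V : set (T -> R)) (w : T -> R) : T -> R :=
  xget (cst 0) [set v | V v /\
    forall a, V a -> (\int[m]_t ((w t - v t) * a t)%:E = 0)%E].

End L2.

Section Model.
Context {R : realType} {dX dY : measure_display}.
Context {X : measurableType dX} {Y : measurableType dY}.

Section Loss.
Context {n : nat}.
Variable u : 'I_n -> {mfun (X * Y)%type >-> R}.

Definition pooled_win (x : X) (y y' : Y) : R :=
  1 / n%:R * \sum_(i < n) sigmoid (u i (x, y) - u i (x, y')).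

Variables (nu : probability X R) (mu : X -> probability Y R).

(* The integrand is nonnegative, so the loss is well defined in [0, +oo]. *)
Definition loss (r : X * Y -> R) : \bar R :=
  (\int[nu]_x \int[mu x \x mu x]_yy
     let p := pooled_win x yy.1 yy.2 in
     let Dr := (r (x, yy.1) - r (x, yy.2))%R in
     (- p * ln (sigmoid Dr) - (1 - p) * ln (1 - sigmoid Dr))%R%:E)%E.

Definition bayes_loss : \bar R :=
  (\int[nu]_x \int[mu x \x mu x]_yy
     let p := pooled_win x yy.1 yy.2 in
     (- p * ln p - (1 - p) * ln (1 - p))%R%:E)%E.

End Loss.

Section Embedding.
Context {d : nat}.
Variable phi : {mfun (X * Y)%type >-> d.-tuple R}.

Definition phi_at (x : X) (y : Y) : d.-tuple R := phi (x, y).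

Lemma measurable_phi_at x : measurable_fun [set: Y] (phi_at x).
Proof. exact: (measurableT_comp (measurable_funPT phi) (pair1_measurable x)). Qed.

HB.instance Definition _ x :=
  isMeasurableFun.Build _ _ _ _ (phi_at x) (measurable_phi_at x).

Definition phi_at2 (x : X) (yy : Y * Y) : d.-tuple R * d.-tuple R :=
  (phi_at x yy.1, phi_at x yy.2).

(* nu_{d,x} *)
Definition embedded_law (mu : X -> probability Y R) (x : X) :
    probability (d.-tuple R) R :=
  distribution (mu x) (phi_at x).

(* nu_{d,x} \otimes nu_{d,x} *)
Definition embedded_law2 (mu : X -> probability Y R) (x : X) :
    {measure set (d.-tuple R * d.-tuple R) -> \bar R} :=
  (embedded_law mu x \x embedded_law mu x)%E.

(* Z_d(x) *)
Definition embedded_values (x : X) : set (d.-tuple R) := range (phi_at x).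

(* Only the values of h on Z_d(x) matter, so h stands for an arbitrary function
   Z_d(x) -> R. *)
Definition difference_space (mu : X -> probability Y R) (x : X) :
    set (d.-tuple R * d.-tuple R -> R) :=
  [set v | v \in Lfun (embedded_law2 mu x) 2%:E /\
    exists h : d.-tuple R -> R, forall z z',
      embedded_values x z -> embedded_values x z' -> v (z, z') = h z - h z'].

(* V_x *)
Definition score_space (mu : X -> probability Y R) (x : X) :
    set (d.-tuple R * d.-tuple R -> R) :=
  L2_closure (embedded_law2 mu x) (difference_space mu x).

(* q (x, (z, z')) is the embedding-induced win probability as a function of the
   embedded values: a version, jointly measurable in (x, z, z'), of the
   conditional expectation of the pooled win probability given
   (phi (x, y0), phi (x, y0')) = (z, z'), with (y0, y0') ~ mu x \x mu x. *)
Definition is_induced_win {n} (u : 'I_n -> {mfun (X * Y)%type >-> R})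
    (nu : probability X R) (mu : X -> probability Y R)
    (q : {mfun (X * (d.-tuple R * d.-tuple R))%type >-> R}) : Prop :=
  {ae nu, forall x,
    is_cond_expectation (mu x \x mu x)%E (phi_at2 x)
      (fun yy => pooled_win u x yy.1 yy.2) (fun zz => q (x, zz))}.

Variable q : {mfun (X * (d.-tuple R * d.-tuple R))%type >-> R}.

Definition induced_win (x : X) (y y' : Y) : R :=
  q (x, (phi_at x y, phi_at x y')).

Definition kappa (x : X) (y y' : Y) : R :=
  induced_win x y y' * (1 - induced_win x y y').

(* W_d *)
Definition score (x : X) (y y' : Y) : R := logit (induced_win x y y').

(* W_d as a function of the embedded values *)
Definition embedded_score (x : X) (zz : d.-tuple R * d.-tuple R) : R :=
  logit (q (x, zz)).

Lemma embedded_scoreE x y y' :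
  embedded_score x (phi_at x y, phi_at x y') = score x y y'.
Proof. by []. Qed.

(* U_x *)
Definition score_residual (mu : X -> probability Y R) (x : X) :
    d.-tuple R * d.-tuple R -> R :=
  embedded_score x \-
    L2_proj (embedded_law2 mu x) (score_space mu x) (embedded_score x).

End Embedding.
End Model.

(* Main.v *)
(** The conditional expectation of the pooled win probability inherits
    [p(y', y) = 1 - p(y, y')], so the score [W_x] is antisymmetric almost
    everywhere and its orthogonal projection onto the differences is explicit:
    it is [h_x(z) - h_x(z')] with [h_x(z) = E W_x(z, z')].  This formula is
    jointly measurable in [(x, z)], which provides the score head without any
    measurable selection, and even without the slack [eps].  For the loss, with
    [s] the induced win probability and [D] the difference between the reward
    gap and [logit s],
      [CE(p, sigmoid(logit s + D)) + (p - s) D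
         <= CE(p, p) + (p - s)^2 / (s (1 - s)) + D^2 / 8]
    pointwise, by [ln x <= x - 1] and the 1/4-Lipschitz continuity of the
    sigmoid; [(p - s) D] has mean zero because [D] is a function of the
    embedded values. *)
From HB Require Import structures.
Require Import Defs.
From mathcomp Require Import all_boot all_order all_algebra.
From mathcomp Require Import all_classical all_reals all_analysis.
From mathcomp Require Import measurable_realfun.
From mathcomp Require Import ring lra.

Import Order.TTheory GRing.Theory Num.Theory.
Import numFieldNormedType.Exports.

Local Open Scope classical_set_scope.
Local Open Scope ring_scope.

(** * Pointwise bounds for the logistic cross-entropy *)

Section CrossEntropy.
Context {R : realType}.
Implicit Types p s t w x : R.

Lemma sigmoid_gt0 t : 0 < sigmoid t.
Proof. by rewrite /sigmoid div1r invr_gt0 addr_gt0// expR_gt0. Qed.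

Lemma onem_sigmoid t : 1 - sigmoid t = sigmoid (- t).
Proof.
rewrite /sigmoid opprK expRN.
have t0 := expR_gt0 t; field.
by rewrite !gt_eqF ?addr_gt0.
Qed.

Lemma sigmoid_lt1 t : sigmoid t < 1.
Proof. by rewrite -subr_gt0 onem_sigmoid sigmoid_gt0. Qed.

(** The log-partition function of the logistic model, an antiderivative of [sigmoid]. It isolates
    the part of the cross-entropy that is nonlinear in the logit and does not involve [p]. *)
Definition softplus t : R := ln (1 + expR t).

Lemma ln_sigmoid t : ln (sigmoid t) = - softplus (- t).
Proof. by rewrite /sigmoid div1r lnV// posrE addr_gt0// expR_gt0. Qed.

Lemma softplusN t : softplus (- t) = softplus t - t.
Proof.
rewrite -[X in _ - X]expRK -ln_div ?posrE ?addr_gt0 ?expR_gt0//.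
congr ln; rewrite expRN mulrDl divff ?gt_eqF ?expR_gt0//.
by rewrite mul1r addrC.
Qed.

Lemma is_derive_1DexpR t : is_derive t 1 (fun x : R => 1 + expR x) (expR t).
Proof.
by apply: is_derive_eq; rewrite add0r mul1r.
Qed.

Lemma is_derive_softplus t : is_derive t 1 softplus (sigmoid t).
Proof.
have e0 := expR_gt0 t.
have t0 : 0 < 1 + expR t by rewrite addr_gt0.
have h := @is_derive1_comp _ (@ln R) (fun x => 1 + expR x) t _ _ (is_derive1_ln t0)
  (is_derive_1DexpR t).
suff -> : sigmoid t = (1 + expR t)^-1 * expR t by exact: h.
rewrite /sigmoid expRN; field.
by rewrite !gt_eqF ?addr_gt0.
Qed.

Lemma is_derive_sigmoid t :
  is_derive t 1 (@sigmoid R) (sigmoid t * (1 - sigmoid t)).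
Proof.
have e0 := expR_gt0 t.
have t0 : 1 + expR t != 0 by rewrite gt_eqF// addr_gt0.
have sE x : sigmoid x = 1 - (1 + expR x)^-1 :> R.
  have ex0 := expR_gt0 x; rewrite /sigmoid expRN; field.
  by rewrite !gt_eqF ?addr_gt0.
have -> : @sigmoid R = (fun x => 1 - (1 + expR x)^-1) by exact/funext.
have h := @is_deriveV _ (fun x => 1 + expR x) _ _ _ t0 (is_derive_1DexpR t).
have e : 0 - - (1 + expR t) ^- 2 *: expR t =
    (1 - (1 + expR t)^-1) * (1 - (1 - (1 + expR t)^-1)).
  by rewrite /GRing.scale /=; field.
by rewrite -e; exact: is_deriveB.
Qed.

(** The mean value theorem for [f'] makes it nondecreasing; the one for [f] gives a chord slope
    [f' c] with [c] between [w] and [t], to be compared with [f' w]. *)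
Lemma tangent_line_le (f f' f'' : R -> R) w t :
  (forall x : R, is_derive x 1 f (f' x)) ->
  (forall x : R, is_derive x 1 f' (f'' x)) ->
  (forall x, 0 <= f'' x) -> f w + f' w * (t - w) <= f t.
Proof.
move=> df df' f''0.
have cts (g g' : R -> R) a b : (forall x : R, is_derive x 1 g (g' x)) ->
    {within `[a, b], continuous g}.
  move=> dg; apply: continuous_subspaceT => x.
  by apply/differentiable_continuous/derivable1_diffP; case: (dg x).
have f'_le a b : a <= b -> f' a <= f' b.
  move=> ab; rewrite -subr_ge0.
  have [c _ ->] := MVT_segment ab (fun x _ => df' x) (cts _ _ _ _ df').
  by rewrite mulr_ge0// subr_ge0.
have [wt|/ltW tw] := leP w t.
- have [c + E] := MVT_segment wt (fun x _ => df x) (cts _ _ _ _ df).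
  rewrite in_itv/= => /andP[wc _].
  rewrite -lerBrDl E ler_wpM2r ?subr_ge0//; exact: f'_le.
- have [c + E] := MVT_segment tw (fun x _ => df x) (cts _ _ _ _ df).
  rewrite in_itv/= => /andP[_ cw].
  have := ler_wpM2r (_ : 0 <= w - t) (f'_le _ _ cw).
  by rewrite subr_ge0 => /(_ tw); lra.
Qed.

(* The second derivative of softplus is sigmoid * (1 - sigmoid) <= 1/4. *)
Lemma softplus_le w t :
  softplus t <= softplus w + sigmoid w * (t - w) + (t - w) ^+ 2 / 8.
Proof.
(* Since [x ^+ 2 / 8] has second derivative 1/4, this [f] is convex, and its tangent line at [w]
   rearranges to the claim. *)
pose f (x : R) := x ^+ 2 / 8 - softplus x.
have := @tangent_line_le f (fun x => x / 4 - sigmoid x)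
  (fun x => 1 / 4 - sigmoid x * (1 - sigmoid x)) w t.
rewrite /f; move=> h.
suff : w ^+ 2 / 8 - softplus w + (w / 4 - sigmoid w) * (t - w) <=
  t ^+ 2 / 8 - softplus t by nra.
apply: h => x.
- have h1 := is_derive_softplus x.
  have h2 : is_derive x 1 (fun x : R => x ^+ 2 / 8) (x / 4).
    have -> : (fun x : R => x ^+ 2 / 8) = 8^-1 \*: (@id R ^+ 2).
      by apply/funext => y; rewrite /= exprfctE mulrC.
    by apply: is_derive_eq; rewrite /GRing.scale /=; field.
  exact: is_deriveB.
- have h1 := is_derive_sigmoid x.
  have h2 : is_derive x 1 (fun x : R => x / 4) (1 / 4).
    have -> : (fun x : R => x / 4) = 4^-1 \*: @id R.
      by apply/funext => y; rewrite /= mulrC.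
    by apply: is_derive_eq; rewrite /GRing.scale /=; field.
  exact: is_deriveB.
- have := sqr_ge0 (sigmoid x - 1 / 2); nra.
Qed.

(** Written so that the integrands of [loss] and [bayes_loss] are convertible to it. *)
Definition cross_entropy p s : R := - p * ln s - (1 - p) * ln (1 - s).

Lemma ln_le_subr1 x : 0 < x -> ln x <= x - 1.
Proof.
by move=> x0; rewrite -[in ln x](subrKC 1 x) le_ln1Dx// ltrBrDl subrr.
Qed.

Lemma cross_entropy_ge0 p s : 0 <= p <= 1 -> 0 < s < 1 ->
  0 <= cross_entropy p s.
Proof.
move=> /andP[p0 p1] /andP[s0 s1].
have h1 : ln s <= 0 by rewrite ln_le0// ltW.
have h2 : ln (1 - s) <= 0 by rewrite ln_le0// gerBl ltW.
rewrite /cross_entropy; nra.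
Qed.

(** Apply [ln x <= x - 1] to the inverses of [p] and [1 - p] and add. The constant 1 is cruder than
    [ln 2], but only finiteness of the entropy integrals is at stake. *)
Lemma entropy_le1 p : 0 < p < 1 -> cross_entropy p p <= 1.
Proof.
move=> /andP[p0 p1]; rewrite /cross_entropy.
have aux (x : R) : 0 < x -> - x * ln x <= 1 - x.
  move=> x0; have := ln_le_subr1 _ (_ : 0 < x^-1).
  rewrite invr_gt0 => /(_ x0); rewrite lnV// => h.
  have := ler_wpM2l (ltW x0) h.
  by rewrite mulrBr mulrV ?unitfE ?gt_eqF// mulr1 mulrN mulNr.
have := aux _ p0; have := aux (1 - p); rewrite subr_gt0 => /(_ p1); lra.
Qed.

(** Relative entropy is dominated by the chi-square divergence: bound the logarithm of the
    likelihood ratio by the ratio minus 1 on each of the two outcomes. *)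
Lemma relative_entropy_le p s : 0 < p < 1 -> 0 < s < 1 ->
  cross_entropy p s <= cross_entropy p p + (p - s) ^+ 2 / (s * (1 - s)).
Proof.
move=> /andP[p0 p1] /andP[s0 s1].
have q0 : 0 < 1 - p by rewrite subr_gt0.
have r0 : 0 < 1 - s by rewrite subr_gt0.
have aux (a b : R) : 0 < a -> 0 < b -> a * ln a - a * ln b <= a * (a / b - 1).
  move=> a0 b0; rewrite -mulrBr -ln_div// ler_pM2l//.
  by apply: ln_le_subr1; rewrite divr_gt0.
have h1 := aux _ _ p0 s0.
have h2 := aux _ _ q0 r0.
have -> : (p - s) ^+ 2 / (s * (1 - s)) =
    p * (p / s - 1) + (1 - p) * ((1 - p) / (1 - s) - 1).
  by field; rewrite !gt_eqF.
by rewrite /cross_entropy; lra.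
Qed.

Lemma cross_entropy_sigmoid p t :
  cross_entropy p (sigmoid t) = softplus t - p * t.
Proof.
rewrite /cross_entropy onem_sigmoid !ln_sigmoid opprK softplusN; ring.
Qed.

(** As a function of the logit, the cross-entropy has slope [s - p] at [logit s] and curvature at
    most 1/4. The linear term is kept on the left because it will integrate to zero. *)
Lemma cross_entropy_excess_le p s t : 0 < p < 1 -> 0 < s < 1 ->
  cross_entropy p (sigmoid t) + (p - s) * (t - logit s) <=
  cross_entropy p p + (p - s) ^+ 2 / (s * (1 - s)) + (t - logit s) ^+ 2 / 8.
Proof.
move=> p01 s01.
have := relative_entropy_le _ _ p01 s01.
rewrite -{1}(logitK s01) !cross_entropy_sigmoid.
have := softplus_le (logit s) t; rewrite logitK//; lra.
Qed.

End CrossEntropy.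

(** * Monotonicity of the integral beyond measurable functions *)

Section IntegralComplements.
Local Open Scope ereal_scope.
Context {R : realType} {d : measure_display} {T : measurableType d}.
Variable m : {measure set T -> \bar R}.

(** The integral of a nonnegative function is a supremum over the simple functions below it, and
    this family grows with the function. *)
Lemma ge0_le_integral_nonmeasurable (f g : T -> \bar R) :
  (forall x, 0 <= f x) -> (forall x, f x <= g x) ->
  \int[m]_x f x <= \int[m]_x g x.
Proof.
move=> f0 fg; have g0 x : 0 <= g x by exact: le_trans (fg x).
rewrite !ge0_integralTE//; apply: le_ereal_sup => _ [h hf <-].
by exists h => // x; exact: le_trans (fg x).
Qed.

(** Meant for a majorant such as the norm of [score_residual] as a function of the prompt, whose
    measurability is unknown. Measurability of [f] allows the exceptional null set to be cut out of
    its integral. *)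
Lemma ae_ge0_le_integral_nonmeasurable (f g : T -> \bar R) :
  measurable_fun [set: T] f -> (forall x, 0 <= f x) -> (forall x, 0 <= g x) ->
  {ae m, forall x, f x <= g x} -> \int[m]_x f x <= \int[m]_x g x.
Proof.
move=> mf f0 g0 [N [mN N0 fgN]].
rewrite (ge0_negligible_integral mN)//.
rewrite setTD integral_mkcond; apply: ge0_le_integral_nonmeasurable => x.
  exact: erestrict_ge0.
rewrite patchE; case: ifPn => // /set_mem Nx.
by apply: contrapT => /fgN.
Qed.

End IntegralComplements.

(** * From preimages of sets to functions of the conditioning variable *)

Section Density.
Local Open Scope ereal_scope.
Context {R : realType} {d1 d2 : measure_display}.
Context {Om : measurableType d1} {T : measurableType d2}.
Variables (P : {measure set Om -> \bar R}) (S : Om -> T).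
Hypothesis mS : measurable_fun [set: Om] S.

Import HBNNSimple.

(** The hypothesis is the case of an indicator [f]. Summing over level sets gives simple functions
    ([sumE]), and monotone convergence gives all nonnegative measurable ones ([limE]). *)
Lemma ge0_integral_mul_comp (a b : Om -> R) (f : T -> \bar R) :
  measurable_fun [set: Om] a -> measurable_fun [set: Om] b ->
  (forall w, 0 <= a w)%R -> (forall w, 0 <= b w)%R ->
  (forall B, measurable B ->
    \int[P]_(w in S @^-1` B) (a w)%:E = \int[P]_(w in S @^-1` B) (b w)%:E) ->
  measurable_fun [set: T] f -> (forall t, 0 <= f t) ->
  \int[P]_w (f (S w) * (a w)%:E) = \int[P]_w (f (S w) * (b w)%:E).
Proof.
move=> ma mb a0 b0 ab mf f0.
pose h := nnsfun_approx measurableT mf.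
have mSB B : measurable B -> measurable (S @^-1` B).
  by move=> mB; rewrite -[_ @^-1` _]setTI; exact: mS.
have limE (c : Om -> R) : measurable_fun [set: Om] c -> (forall w, 0 <= c w)%R ->
    \int[P]_w (f (S w) * (c w)%:E) =
    limn (fun n => \int[P]_w ((h n (S w))%:E * (c w)%:E)).
  move=> mc c0.
  rewrite -monotone_convergence//.
  - apply: eq_integral => w _; apply/esym/cvg_lim => //.
    by apply: cvgeZr => //; exact: cvg_nnsfun_approx.
  - move=> n; apply: emeasurable_funM; apply/measurable_EFinP => //.
    exact: measurableT_comp.
  - by move=> n w _; rewrite mule_ge0// lee_fin.
  - move=> w _ i j ij; rewrite lee_wpmul2r ?lee_fin//.
    exact/lefP/nd_nnsfun_approx.
rewrite (limE a)// (limE b)//; congr (limn _); apply/funext => n.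
have sumE (c : Om -> R) : measurable_fun [set: Om] c -> (forall w, 0 <= c w)%R ->
    \int[P]_w ((h n (S w))%:E * (c w)%:E) =
    \sum_(r \in range (h n))
      r%:E * \int[P]_(w in S @^-1` (h n @^-1` [set r])) (c w)%:E.
  move=> mc c0.
  have r0 r : range (h n) r -> (0 <= r)%R by case=> t _ <-.
  have mi r : measurable_fun [set: Om]
      (fun w => (\1_(h n @^-1` [set r]) (S w) * c w)%:E).
    apply/measurable_EFinP; apply: measurable_funM => //.
    exact: measurableT_comp.
  transitivity (\int[P]_w \sum_(r \in range (h n))
      (r%:E * (\1_(h n @^-1` [set r]) (S w) * c w)%:E)).
    apply: eq_integral => w _.
    rewrite {1}fimfunE -fsumEFin//.
    rewrite ge0_mule_fsuml//.
      by apply: eq_fsbigr => r _; rewrite -EFinM -mulrA EFinM.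
    by move=> r; rewrite nnfun_muleindic_ge0.
  rewrite ge0_integral_fsum//; last 2 first.
  - by move=> r; exact: emeasurable_funM.
  - move=> r w _; rewrite -EFinM mulrA EFinM.
    by apply: mule_ge0; [exact: nnfun_muleindic_ge0|rewrite lee_fin].
  apply: eq_fsbigr => r /set_mem rh.
  rewrite ge0_integralZl//; last 2 first.
  - by move=> w _; rewrite lee_fin mulr_ge0.
  - by rewrite lee_fin r0.
  congr (_ * _); rewrite [RHS]integral_mkcond.
  apply: eq_integral => w _; rewrite patchE indicE /=.
  have -> : (w \in S @^-1` (h n @^-1` [set r])) = (S w \in h n @^-1` [set r]).
    by [].
  by case: (_ \in _); rewrite ?mul1r ?mul0r.
rewrite (sumE a)// (sumE b)//.
by apply: eq_fsbigr => r _; rewrite ab.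
Qed.

End Density.

(** * Measurable dependence of integrals on the prompt *)

Section KernelIntegral.
Local Open Scope ereal_scope.
Context {R : realType} {dX dY : measure_display}.
Context {X : measurableType dX} {Y : measurableType dY}.
Variable mu : X -> probability Y R.
Hypothesis hmu :
  forall A, measurable A -> measurable_fun [set: X] (fun x => mu x A).

Let l : X -> {measure set Y -> \bar R} := fun x => mu x.

#[local] HB.instance Definition _ := isKernel.Build _ _ _ _ R l hmu.

Let l_setT x : l x [set: Y] = 1. Proof. exact: probability_setT. Qed.

#[local] HB.instance Definition _ :=
  Kernel_isProbability.Build _ _ _ _ R l l_setT.

Lemma measurable_integral_kernel (k : X * Y -> \bar R) :
  measurable_fun [set: X * Y] k -> (forall z, 0 <= k z) ->
  measurable_fun [set: X] (fun x => \int[mu x]_y k (x, y)).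
Proof.
by move=> mk k0; exact: (measurable_fun_integral_finite_kernel k l).
Qed.

End KernelIntegral.

Section KernelIntegral2.
Local Open Scope ereal_scope.
Context {R : realType} {dX dY : measure_display}.
Context {X : measurableType dX} {Y : measurableType dY}.
Variable mu : X -> probability Y R.
Hypothesis hmu :
  forall A, measurable A -> measurable_fun [set: X] (fun x => mu x A).

(** Composing the kernel with [f] gives a kernel from [Z]. This allows parameters such as [(x, y)]
    or [(x, z)] when the measure depends on [x] alone. *)
Lemma measurable_integral_kernel_comp {dZ : measure_display}
    {Z : measurableType dZ} (f : Z -> X) (k : Z * Y -> \bar R) :
  measurable_fun [set: Z] f ->
  measurable_fun [set: Z * Y] k -> (forall z, 0 <= k z) ->
  measurable_fun [set: Z] (fun z => \int[mu (f z)]_y k (z, y)).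
Proof.
move=> mf mk k0.
apply: (measurable_integral_kernel (fun z => mu (f z))) => // A mA.
exact: measurableT_comp (hmu A mA) mf.
Qed.

(** Tonelli splits the integral over pairs into two successive kernel integrals, the inner one with
    parameter [(x, y)]. *)
Lemma measurable_integral_kernel2 (k : X * (Y * Y) -> \bar R) :
  measurable_fun [set: X * (Y * Y)] k -> (forall z, 0 <= k z) ->
  measurable_fun [set: X] (fun x => \int[mu x \x mu x]_yy k (x, yy)).
Proof.
move=> mk k0.
have E x : \int[mu x \x mu x]_yy k (x, yy) =
    \int[mu x]_y \int[mu x]_y' k (x, (y, y')).
  rewrite (fubini_tonelli1 (fun yy => k (x, yy)))//.
  exact: measurableT_comp.
under eq_fun do rewrite E.
apply: (measurable_integral_kernel mu hmu
  (fun xy => \int[mu xy.1]_y' k (xy.1, (xy.2, y')))) => //; last first.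
  by move=> z; exact: integral_ge0.
apply: (measurable_integral_kernel_comp fst
  (fun z => k (z.1.1, (z.1.2, z.2)))) => //.
apply: measurableT_comp => //.
apply: measurable_fun_pair; first exact: measurableT_comp.
by apply: measurable_fun_pair => //; exact: measurableT_comp.
Qed.

(** Positive and negative parts are treated separately; the score, which is averaged to form the
    head, has no fixed sign. *)
Lemma measurable_integral_kernel_comp_sign {dZ : measure_display}
    {Z : measurableType dZ} (f : Z -> X) (k : Z * Y -> \bar R) :
  measurable_fun [set: Z] f -> measurable_fun [set: Z * Y] k ->
  measurable_fun [set: Z] (fun z => \int[mu (f z)]_y k (z, y)).
Proof.
move=> mf mk; under eq_fun do rewrite integralE.
apply: emeasurable_funB.
- under eq_fun do under eq_integral do rewrite (funepos_comp k).
  apply: measurable_integral_kernel_comp => //.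
  exact: measurable_funepos.
- under eq_fun do under eq_integral do rewrite (funeneg_comp k).
  apply: measurable_integral_kernel_comp => //.
  exact: measurable_funeneg.
Qed.

Lemma measurable_integral_kernel2_sign (k : X * (Y * Y) -> \bar R) :
  measurable_fun [set: X * (Y * Y)] k ->
  measurable_fun [set: X] (fun x => \int[mu x \x mu x]_yy k (x, yy)).
Proof.
move=> mk; under eq_fun do rewrite integralE.
apply: emeasurable_funB.
- under eq_fun do under eq_integral do rewrite (funepos_comp k).
  by apply: measurable_integral_kernel2 => //; exact: measurable_funepos.
- under eq_fun do under eq_integral do rewrite (funeneg_comp k).
  by apply: measurable_integral_kernel2 => //; exact: measurable_funeneg.
Qed.

End KernelIntegral2.

(** * Square integrability through the integral of the square *)

Section SquareIntegrable.
Local Open Scope ereal_scope.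
Context {R : realType} {d : measure_display} {T : measurableType d}.
Variable m : {measure set T -> \bar R}.

Lemma poweR2 (x : \bar R) : 0 <= x -> x `^ 2 = x ^+ 2.
Proof.
case: x => [r| |]//; last by rewrite poweRyr// expe2 mulyy.
by rewrite lee_fin => r0; rewrite poweR_EFin powR_mulrn.
Qed.

Lemma Lnorm2E (f : T -> R) :
  'N[m]_2%:E[EFin \o f] ^+ 2 = \int[m]_t ((f t) ^+ 2)%:E.
Proof.
rewrite -poweR2 ?Lnorm_ge0// poweR_Lnorm//.
by apply: eq_integral => t _ /=; rewrite powR_mulrn// real_normK// num_real.
Qed.

Lemma Lfun2P (f : T -> R) : f \in Lfun m 2%:E <->
  measurable_fun [set: T] f /\ \int[m]_t ((f t) ^+ 2)%:E < +oo.
Proof.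
rewrite -Lnorm2E inE; split.
  move=> /andP[/set_mem mf /set_mem Nf]; split => //.
  by rewrite lte_mul_pinfty// ?Lnorm_ge0// ge0_fin_numE// Lnorm_ge0.
move=> [mf Nf]; apply/andP; split; apply/mem_set => //.
rewrite /= /finite_norm ltNge leye_eq; apply: contraTN Nf => /eqP ->.
by rewrite expe2 mulyy ltxx.
Qed.

End SquareIntegrable.

(** * Invariance of the product measure under exchange of the two responses *)

Section Swap.
Local Open Scope ereal_scope.
Context {R : realType} {d : measure_display} {Y : measurableType d}.
Variable P : probability Y R.

(** By uniqueness of the product measure it is enough to look at rectangles, where the two factors
    commute. *)
Lemma product_measure_swap (A : set (Y * Y)) : measurable A ->
  (P \x P) A = pushforward (P \x P) (@unstable.swap Y Y) A.
Proof.
move=> mA.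
have ms : measurable_fun [set: Y * Y] (@unstable.swap Y Y) by exact: measurable_swap.
pose ms' := isMeasurableFun.Build _ _ _ _ _ ms.
pose s : {mfun (Y * Y)%type >-> (Y * Y)%type} := HB.pack (@unstable.swap Y Y) ms'.
apply: (@product_measure_unique _ _ _ _ _ P P (pushforward (P \x P) s)) => // B C mB mC.
rewrite /= /pushforward.
have -> : s @^-1` (B `*` C) = C `*` B.
  by apply/seteqP; split => -[y y'] /= [].
by rewrite product_measure1E// muleC.
Qed.

Lemma ge0_integral_swap (f : Y * Y -> \bar R) (D : set (Y * Y)) :
  measurable D -> measurable_fun [set: Y * Y] f -> (forall yy, 0 <= f yy) ->
  \int[P \x P]_(yy in unstable.swap @^-1` D) f (unstable.swap yy) =
  \int[P \x P]_(yy in D) f yy.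
Proof.
move=> mD mf f0.
have ms : measurable_fun [set: Y * Y] (@unstable.swap Y Y) by exact: measurable_swap.
rewrite -(@ge0_integral_pushforward _ _ _ _ _ _ ms (P \x P) D f)//; last first.
  exact: measurable_funS mf.
by apply: eq_measure_integral => B mB _; apply: (esym (product_measure_swap _ mB)).
Qed.

Lemma integrable_swap (f : Y * Y -> \bar R) :
  (P \x P).-integrable setT f -> (P \x P).-integrable setT (f \o unstable.swap).
Proof.
move=> /integrableP[mf fi]; apply/integrableP; split.
  by apply: measurableT_comp => //; exact: measurable_swap.
have := ge0_integral_swap (abse \o f) setT measurableT.
rewrite preimage_setT => /= ->//.
exact: measurableT_comp.
Qed.

Lemma integral_swap_in (f : Y * Y -> \bar R) (D : set (Y * Y)) :
  measurable D -> measurable_fun [set: Y * Y] f ->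
  \int[P \x P]_(yy in unstable.swap @^-1` D) f (unstable.swap yy) =
  \int[P \x P]_(yy in D) f yy.
Proof.
move=> mD mf; rewrite integralE [RHS]integralE.
rewrite -(ge0_integral_swap (f^\+) D)//; last exact: measurable_funepos.
rewrite -(ge0_integral_swap (f^\-) D)//; last exact: measurable_funeneg.
rewrite -[X in (\int[_]_(x in _) X^\+ x)%E]/(f \o unstable.swap).
rewrite -[X in (_ - \int[_]_(x in _) X^\- x)%E]/(f \o unstable.swap).
by rewrite funepos_comp funeneg_comp.
Qed.

Lemma integral_swap (f : Y * Y -> \bar R) : measurable_fun [set: Y * Y] f ->
  \int[P \x P]_yy f (unstable.swap yy) = \int[P \x P]_yy f yy.
Proof. by move=> mf; rewrite -(integral_swap_in f setT)// preimage_setT. Qed.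

End Swap.

(** * Projection of an antisymmetric kernel onto differences *)

Section AntisymmetricProjection.
Local Open Scope ereal_scope.
Context {R : realType} {d : measure_display} {Y : measurableType d}.
Variable P : probability Y R.
Local Notation P2 := (P \x P).

Definition difference (c : Y -> R) (yy : Y * Y) : R := (c yy.1 - c yy.2)%R.

Lemma integral_comp_fst (f : Y -> \bar R) : measurable_fun [set: Y] f ->
  (forall y, 0 <= f y) -> \int[P2]_yy f yy.1 = \int[P]_y f y.
Proof.
move=> mf f0; rewrite (fubini_tonelli1 (f \o fst))//=; last first.
  exact: measurableT_comp.
apply: eq_integral => y _.
by rewrite /fubini_F/= integral_cst// [X in _ * X]probability_setT mule1.
Qed.

Lemma integral_comp_snd (f : Y -> \bar R) : measurable_fun [set: Y] f ->
  (forall y, 0 <= f y) -> \int[P2]_yy f yy.2 = \int[P]_y f y.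
Proof.
move=> mf f0; rewrite (fubini_tonelli2 (f \o snd))//=; last first.
  exact: measurableT_comp.
apply: eq_integral => y _.
by rewrite /fubini_G/= integral_cst// [X in _ * X]probability_setT mule1.
Qed.

Lemma Lfun2_comp_fst (c : Y -> R) :
  c \in Lfun P 2%:E -> c \o fst \in Lfun P2 2%:E.
Proof.
move=> /Lfun2P[mc c2]; apply/Lfun2P; split; first exact: measurableT_comp.
rewrite /= (integral_comp_fst (fun y => (c y ^+ 2)%:E))//.
  by apply/measurable_EFinP; exact: measurable_funX.
by move=> y; rewrite lee_fin sqr_ge0.
Qed.

Lemma Lfun2_comp_snd (c : Y -> R) :
  c \in Lfun P 2%:E -> c \o snd \in Lfun P2 2%:E.
Proof.
move=> /Lfun2P[mc c2]; apply/Lfun2P; split; first exact: measurableT_comp.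
rewrite /= (integral_comp_snd (fun y => (c y ^+ 2)%:E))//.
  by apply/measurable_EFinP; exact: measurable_funX.
by move=> y; rewrite lee_fin sqr_ge0.
Qed.

Let le12 : 1 <= 2%:E :> \bar R. Proof. by rewrite lee_fin ler1n. Qed.

Lemma Lfun2B {d'} {T : measurableType d'} (m : {measure set T -> \bar R})
    (f g : T -> R) :
  f \in Lfun m 2%:E -> g \in Lfun m 2%:E -> (f \- g)%R \in Lfun m 2%:E.
Proof.
move=> fL gL.
have -> : (f \- g)%R = ((f : T -> R^o) + (-1) *: (g : T -> R^o))%R.
  by apply/funext => t /=; rewrite scaleN1r.
have [_ h] := Lfun_submod_closed m le12.
by rewrite addrC; exact: h.
Qed.

Lemma Lfun2_difference (c : Y -> R) :
  c \in Lfun P 2%:E -> difference c \in Lfun P2 2%:E.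
Proof.
by move=> cL; apply: Lfun2B; [exact: Lfun2_comp_fst|exact: Lfun2_comp_snd].
Qed.

Lemma Lfun2_integrable {d'} {T : measurableType d'} (Q : probability T R)
    (f : T -> R) : f \in Lfun Q 2%:E -> Q.-integrable setT (EFin \o f).
Proof.
move=> fL; apply/Lfun1_integrable; apply: Lfun_subset12 fL.
exact: fin_num_measure.
Qed.

Lemma probability_integrable_cst {d'} {T : measurableType d'}
    (Q : probability T R) (k : R) (A : set T) :
  measurable A -> Q.-integrable A (EFin \o cst k).
Proof. exact: finite_measure_integrable_cst. Qed.

(* The orthogonal projection of an antisymmetric square-integrable kernel onto
   the space of differences is the difference of its conditional mean. *)
Definition row_mean (W : Y * Y -> R) (y : Y) : R :=
  fine (\int[P]_y' (W (y, y'))%:E).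

Section RowMean.
Variable W : Y * Y -> R.
Hypothesis mW : measurable_fun [set: Y * Y] W.

Lemma measurable_row_mean : measurable_fun [set: Y] (row_mean W).
Proof.
apply: measurableT_comp => //.
apply: (measurable_integral_kernel_comp_sign (fun _ : Y => P) _ id
  (fun yy => (W yy)%:E)) => //.
exact/measurable_EFinP.
Qed.

(** Jensen for the square on one row: integrate the tangent inequality [2 h W - h^2 <= W^2] at the
    mean [h]. *)
Lemma row_mean_sqr_le y :
  ((row_mean W y) ^+ 2)%:E <= \int[P]_y' ((W (y, y')) ^+ 2)%:E.
Proof.
(* An infinite right-hand side is trivial; otherwise the row is integrable, so [fine] returns its
   true mean. *)
have [->|] := eqVneq (\int[P]_y' (W (y, y') ^+ 2)%:E) +oo; first by rewrite leey.
rewrite -ltey => W2.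
have mWy : measurable_fun [set: Y] (fun y' => W (y, y')).
  exact: measurableT_comp.
have WL : (fun y' => W (y, y')) \in Lfun P 2%:E by apply/Lfun2P.
have W1 : P.-integrable setT (fun y' => (W (y, y'))%:E).
  exact: Lfun2_integrable WL.
have W2i : P.-integrable setT (fun y' => (W (y, y') ^+ 2)%:E).
  exact: Lfun2_integrable_sqr WL.
set h := row_mean W y.
have hE : \int[P]_y' (W (y, y'))%:E = h%:E.
  by rewrite fineK//; exact: integrable_fin_num.
have hi : P.-integrable setT (fun y' => ((2 * h) * W (y, y'))%:E).
  by under eq_fun do rewrite EFinM; exact: integrableZl.
have ci : P.-integrable setT (fun _ : Y => (h ^+ 2)%:E).
  exact: finite_measure_integrable_cst.
have <- : \int[P]_y' (((2 * h) * W (y, y'))%:E - (h ^+ 2)%:E) = (h ^+ 2)%:E.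
  rewrite integralB// integral_cst// [X in _ * X]probability_setT mule1.
  under eq_integral do rewrite EFinM.
  rewrite integralZl// hE -EFinM -EFinB; congr (_%:E); ring.
apply: le_integral => //; first exact: integrableB.
move=> y' _; rewrite -EFinB lee_fin.
by have := sqr_ge0 (W (y, y') - h); lra.
Qed.

Hypothesis WL : W \in Lfun P2 2%:E.

Lemma Lfun2_row_mean : row_mean W \in Lfun P 2%:E.
Proof.
have /Lfun2P[_ W2] := WL.
have mW2 : measurable_fun [set: Y * Y] (fun yy => (W yy ^+ 2)%:E).
  by apply/measurable_EFinP; exact: measurable_funX.
apply/Lfun2P; split; first exact: measurable_row_mean.
apply: le_lt_trans W2.
rewrite (fubini_tonelli1 (fun yy => (W yy ^+ 2)%:E))//; last first.
  by move=> yy; rewrite lee_fin sqr_ge0.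
apply: ge0_le_integral_nonmeasurable => y; first by rewrite lee_fin sqr_ge0.
exact: row_mean_sqr_le.
Qed.

Let A := (W \- difference (row_mean W))%R.

Lemma Lfun2_row_residual : A \in Lfun P2 2%:E.
Proof. by apply: Lfun2B => //; exact/Lfun2_difference/Lfun2_row_mean. Qed.

Hypothesis anti : {ae P2, forall yy, W (unstable.swap yy) = (- W yy)%R}.

Let W_integrable : P2.-integrable setT (EFin \o W).
Proof. exact: Lfun2_integrable WL. Qed.

(** Swap invariance makes the integral equal to its own opposite, and integrability makes it
    finite. *)
Lemma integral_antisymmetric (f : Y * Y -> R) :
  P2.-integrable setT (EFin \o f) ->
  {ae P2, forall yy, f (unstable.swap yy) = (- f yy)%R} ->
  \int[P2]_yy (f yy)%:E = 0.
Proof.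
move=> fi fanti.
have ffin : \int[P2]_yy (f yy)%:E \is a fin_num.
  exact: (integrable_fin_num measurableT fi).
have : \int[P2]_yy (f yy)%:E = (-1)%:E * \int[P2]_yy (f yy)%:E.
  have [mf _] := integrableP _ _ _ fi.
  rewrite -{1}(integral_swap P (EFin \o f))// -integralZl//.
  apply: ae_eq_integral => //.
  - by apply: measurableT_comp => //; exact: measurable_swap.
  - exact: emeasurable_funM.
  - by apply: filterS fanti => yy /= E _; rewrite E -EFinM mulN1r.
rewrite -(fineK ffin) -EFinM => -[].
by move=> E; congr (_%:E); lra.
Qed.

Let integral_row_mean : \int[P]_y (row_mean W y)%:E = 0.
Proof.
rewrite -(integral_antisymmetric W)// -(integral12_prod_meas1 W_integrable).
apply: ae_eq_integral => //.
- by apply/measurable_EFinP; exact: measurable_row_mean.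
- exact: (measurable_fubini_F W_integrable).
- apply: filterS (ae_integrable1 W_integrable) => y Wy _.
  by rewrite /row_mean fineK//; exact: integrable_fin_num.
Qed.

(** Averaging over [y'], [W] contributes [row_mean W y], which cancels, and the term [row_mean W y']
    contributes 0 by antisymmetry. Fubini gives integrability of almost every row only. *)
Let ae_row_residual :
  {ae P, forall y, \int[P]_y' (A (y, y'))%:E = 0}.
Proof.
have hi : P.-integrable setT (EFin \o row_mean W).
  exact: Lfun2_integrable Lfun2_row_mean.
apply: filterS (ae_integrable1 W_integrable) => y Wy.
have ci : P.-integrable setT (EFin \o cst (row_mean W y)).
  exact: finite_measure_integrable_cst.
transitivity (\int[P]_y' ((W (y, y'))%:E - (row_mean W y)%:E +
    (row_mean W y')%:E)).
  apply: eq_integral => y' _; rewrite -EFinB -EFinD /A /difference/=.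
  by congr (_%:E); ring.
rewrite integralD//; last exact: integrableB.
rewrite integral_row_mean adde0 integralB//.
rewrite integral_cst// [X in _ * X]probability_setT mule1.
by rewrite /row_mean fineK ?subee//; exact: integrable_fin_num.
Qed.

Let A_swap : {ae P2, forall yy, A (unstable.swap yy) = (- A yy)%R}.
Proof.
by apply: filterS anti => -[y y'] E; rewrite /A /difference /= E/=; ring.
Qed.

(** Against [c yy.1], Fubini reduces to the vanishing row integrals of the residual. The term with
    [c yy.2] becomes the opposite of the first one after a swap, because the residual is
    antisymmetric. *)
Lemma row_residual_orthogonal (c : Y -> R) : c \in Lfun P 2%:E ->
  \int[P2]_yy (A yy * difference c yy)%:E = 0.
Proof.
move=> cL.
have A1 : P2.-integrable setT (EFin \o (A \* (c \o fst))%R).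
  apply/Lfun1_integrable; apply: Lfun2_mul_Lfun1 => //.
  - exact: Lfun2_row_residual.
  - exact: Lfun2_comp_fst.
have A2 : P2.-integrable setT (EFin \o (A \* (c \o snd))%R).
  apply/Lfun1_integrable; apply: Lfun2_mul_Lfun1 => //.
  - exact: Lfun2_row_residual.
  - exact: Lfun2_comp_snd.
have I1 : \int[P2]_yy (A yy * c yy.1)%:E = 0.
  rewrite -(integral12_prod_meas1 A1) -[RHS](@integral0 _ _ _ P setT).
  apply: ae_eq_integral => //; first exact: (measurable_fubini_F A1).
  have AL := Lfun2_row_residual.
  have Ai : P2.-integrable setT (EFin \o A).
    exact: Lfun2_integrable AL.
  apply: filterS2 ae_row_residual (ae_integrable1 Ai) => y Ay0 Ayi _.
  rewrite /fubini_F /=.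
  under eq_integral do rewrite mulrC EFinM.
  by rewrite integralZl// Ay0 mule0.
have I2 : \int[P2]_yy (A yy * c yy.2)%:E = 0.
  have [mA2 _] := integrableP _ _ _ A2.
  rewrite -(integral_swap P _ mA2).
  transitivity ((-1)%:E * \int[P2]_yy (A yy * c yy.1)%:E); last first.
    by rewrite I1 mule0.
  rewrite -(@integralZl _ _ _ P2 _ measurableT _ A1).
  apply: ae_eq_integral => //.
  - by apply: measurableT_comp => //; exact: measurable_swap.
  - by apply: emeasurable_funM => //; have [] := integrableP _ _ _ A1.
  - apply: filterS A_swap => yy /= E _.
    by rewrite E -EFinM; congr (_%:E); ring.
transitivity (\int[P2]_yy ((A yy * c yy.1)%:E - (A yy * c yy.2)%:E)).
  by apply: eq_integral => yy _; rewrite -EFinB /difference mulrBr.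
by rewrite integralB// I1 I2 sube0.
Qed.

(** Pythagoras: with [e = c - row_mean W], the competitor is [A - difference e], and the cross term
    vanishes by orthogonality. *)
Lemma row_mean_minimal (c : Y -> R) : c \in Lfun P 2%:E ->
  \int[P2]_yy (A yy ^+ 2)%:E <=
  \int[P2]_yy ((W yy - difference c yy) ^+ 2)%:E.
Proof.
move=> cL.
pose e := (c \- row_mean W)%R.
have eL : e \in Lfun P 2%:E by apply: Lfun2B => //; exact: Lfun2_row_mean.
have AL := Lfun2_row_residual.
have A2 := Lfun2_integrable_sqr AL.
have Ae : P2.-integrable setT (EFin \o (A \* difference e)%R).
  apply/Lfun1_integrable; apply: Lfun2_mul_Lfun1 => //.
  exact: Lfun2_difference.
have cL2 := Lfun2_integrable_sqr (Lfun2B P2 _ _ WL (Lfun2_difference _ cL)).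
have Ae2 : P2.-integrable setT (fun yy => 2%:E * (A yy * difference e yy)%:E).
  exact: integrableZl.
have -> : \int[P2]_yy (A yy ^+ 2)%:E =
    \int[P2]_yy ((A yy ^+ 2)%:E - 2%:E * (A yy * difference e yy)%:E).
  rewrite integralB// integralZl// row_residual_orthogonal//.
  by rewrite mule0 sube0.
apply: le_integral => //; first exact: integrableB.
move=> yy _; rewrite -EFinM -EFinB lee_fin.
have -> : (W yy - difference c yy = A yy - difference e yy)%R.
  by rewrite /A /e /difference /=; ring.
by have := sqr_ge0 (difference e yy); lra.
Qed.

End RowMean.
End AntisymmetricProjection.

(** * The induced win probability as a conditional expectation *)

Section ConditionalExpectationOnPairs.
Local Open Scope ereal_scope.
Context {R : realType} {dY dT : measure_display}.
Context {Y : measurableType dY} {T : measurableType dT}.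
Variables (P : probability Y R) (f : Y -> T).
Hypothesis mf : measurable_fun [set: Y] f.
Local Notation P2 := (P \x P).

Let S (yy : Y * Y) : T * T := (f yy.1, f yy.2).

Let mS : measurable_fun [set: Y * Y] S.
Proof. by apply: measurable_fun_pair; exact: measurableT_comp. Qed.

Let mSB B : measurable B -> measurable (S @^-1` B).
Proof. by move=> mB; rewrite -[_ @^-1` _]setTI; exact: mS. Qed.

Variables (p : Y * Y -> R) (q : T * T -> R).
Hypothesis mp : measurable_fun [set: Y * Y] p.
Hypothesis p01 : forall yy, (0 <= p yy <= 1)%R.
Hypothesis pq : is_cond_expectation P2 S p q.

Let mq : measurable_fun [set: T * T] q. Proof. by case: pq. Qed.

Let mqS : measurable_fun [set: Y * Y] (q \o S).
Proof. exact: measurableT_comp. Qed.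

Let qi : P2.-integrable setT (EFin \o (q \o S)). Proof. by case: pq. Qed.

Let pi : P2.-integrable setT (EFin \o p).
Proof.
apply: (@le_integrable _ _ _ P2 _ measurableT _ (EFin \o cst 1%R)).
- exact/measurable_EFinP.
- move=> yy _ /=; rewrite lee_fin normr1 ger0_norm.
    by have /andP[] := p01 yy.
  by have /andP[] := p01 yy.
- exact: probability_integrable_cst.
Qed.

(** Uniqueness of conditional expectations: [1 - q] after a swap has the same integrals as [q] over
    all measurable sets of embedded pairs, so the two agree almost everywhere for the law of [S]. *)
Lemma cond_expectation_onem_swap :
  (forall yy, p (unstable.swap yy) = 1 - p yy)%R ->
  {ae P2, forall yy, q (S (unstable.swap yy)) = (1 - q (S yy))%R}.
Proof.
move=> p_swap.
pose q' zz := (1 - q (unstable.swap zz))%R.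
have ms (d : measure_display) (U : measurableType d) :
    measurable_fun [set: U * U] (@unstable.swap U U).
  exact: measurable_swap.
have mq' : measurable_fun [set: T * T] q'.
  by apply: measurable_funB => //; exact: (measurableT_comp mq (ms _ T)).
pose S0 := isMeasurableFun.Build _ _ _ _ _ mS.
pose s : {mfun (Y * Y)%type >-> (T * T)%type} := HB.pack S S0.
have qi' : (pushforward P2 s).-integrable setT (EFin \o q).
  apply: integrable_pushforward => //.
  exact/measurable_EFinP.
have one_i B : measurable B -> P2.-integrable B (EFin \o cst 1%R).
  exact: probability_integrable_cst.
have qsi : P2.-integrable setT (EFin \o (q \o S) \o unstable.swap).
  exact: integrable_swap.
have psi : P2.-integrable setT (EFin \o p \o unstable.swap).
  exact: integrable_swap.
have qq' : forall B, B `<=` setT -> measurable B ->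
    \int[pushforward P2 s]_(zz in B) (EFin \o q) zz =
    \int[pushforward P2 s]_(zz in B) (EFin \o q') zz.
  move=> B _ mB.
  have sub C : measurable C -> C `<=` [set: Y * Y] by [].
  rewrite integral_pushforward//; last 2 first.
  - exact/measurable_EFinP.
  - by apply: integrableS qi => //; exact: mSB.
  rewrite integral_pushforward//; last 2 first.
  - exact/measurable_EFinP.
  - apply: (@integrableS _ _ _ _ setT) => //; first exact: mSB.
    have -> : EFin \o q' \o s =
        (EFin \o cst 1%R) \- (EFin \o (q \o S) \o unstable.swap) by [].
    by apply: integrableB => //; exact: one_i.
  rewrite /=; case: pq => _ _ ->//.
  have mB' : measurable (unstable.swap @^-1` B).
    by rewrite -[_ @^-1` _]setTI; exact: ms.
  pose SB' := S @^-1` (unstable.swap @^-1` B).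
  have mSB' : measurable SB' by exact: mSB.
  (* [S] commutes with the swaps, since both responses are embedded by the same map. *)
  have SBE : S @^-1` B = unstable.swap @^-1` SB'.
    by apply/seteqP; split => -[y y'].
  transitivity (\int[P2]_(yy in S @^-1` B)
     ((EFin \o cst 1%R) yy - (EFin \o p \o unstable.swap) yy)).
    by apply: eq_integral => yy _ /=; rewrite p_swap -EFinB opprB addrCA subrr addr0.
  transitivity (\int[P2]_(yy in S @^-1` B)
     ((EFin \o cst 1%R) yy - (EFin \o (q \o S) \o unstable.swap) yy)); last by [].
  have mSB0 := mSB _ mB.
  rewrite integralB//; [|exact: one_i|exact: integrableS psi].
  rewrite [RHS]integralB//; [|exact: one_i|exact: integrableS qsi].
  congr (_ - _).
  rewrite SBE (integral_swap_in P (EFin \o p))//; last exact/measurable_EFinP.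
  rewrite (integral_swap_in P (EFin \o (q \o S)))//; last exact/measurable_EFinP.
  by case: pq => _ _ ->.
(* The exceptional set is null for the law of [S]; its preimage is null for [P2]. *)
have [N [mN N0 EN]] :=
  integral_ae_eq measurableT qi' (proj2 (measurable_EFinP _ _) mq') qq'.
exists (S @^-1` N); split => //; first exact: mSB.
move=> yy /= qyy; apply: EN => /= /(_ Logic.I) [qE]; apply: qyy.
by rewrite qE subKr.
Qed.

(** This removes the first-order term of the loss: the defining property of [q], given on preimages
    of sets, is extended to integrable functions of the embedded pair. *)
Lemma cond_expectation_orthogonal (D : T * T -> R) :
  {ae P2, forall yy, (0 <= q (S yy) <= 1)%R} ->
  measurable_fun [set: T * T] D ->
  P2.-integrable setT (EFin \o (D \o S)) ->
  \int[P2]_yy ((p yy - q (S yy)) * D (S yy))%:E = 0.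
Proof.
move=> q01 mD iD.
(* Clipping changes [q] on a null set only, and provides the everywhere nonnegative bounded factor
   that [ge0_integral_mul_comp] and [mul_int] ask for. *)
pose b yy := Num.min 1%R (Num.max 0%R (q (S yy))).
have mb : measurable_fun [set: Y * Y] b.
  by apply: measurable_minr => //; exact: measurable_maxr.
have b01 yy : (0 <= b yy <= 1)%R.
  by rewrite /b le_min ler01 le_max lexx ge_min lexx.
have bq : {ae P2, forall yy, b yy = q (S yy)}.
  apply: filterS q01 => yy /andP[q0 q1].
  by rewrite /b (max_idPr q0) (min_idPr q1).
have pb B : measurable B ->
    \int[P2]_(yy in S @^-1` B) (p yy)%:E = \int[P2]_(yy in S @^-1` B) (b yy)%:E.
  move=> mB; case: pq => _ _ /(_ _ mB) <-.
  apply: ae_eq_integral; [exact: mSB|..].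
  - by apply: measurable_funTS; exact/measurable_EFinP.
  - by apply: measurable_funTS; exact/measurable_EFinP.
  - by apply: filterS bq => yy /= -> _.
pose Dp t := Num.max (D t) 0%R; pose Dn t := Num.max (- D t)%R 0%R.
have mDp : measurable_fun [set: T * T] Dp by exact: measurable_maxr.
have mDn : measurable_fun [set: T * T] Dn.
  by apply: measurable_maxr => //; exact: measurableT_comp.
have DE t : D t = (Dp t - Dn t)%R.
  rewrite /Dp /Dn; have [D0|D0] := leP 0%R (D t).
    by rewrite max_r ?subr0// oppr_le0.
  by rewrite max_l ?sub0r ?opprK// oppr_ge0 ltW.
have iDp : P2.-integrable setT (EFin \o (Dp \o S)).
  apply: le_integrable iD => //.
    by apply/measurable_EFinP; exact: measurableT_comp.
  move=> yy _ /=; rewrite lee_fin /Dp.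
  by have [] := leP 0%R (D (S yy)); rewrite ?normr0.
have iDn : P2.-integrable setT (EFin \o (Dn \o S)).
  apply: le_integrable iD => //.
    by apply/measurable_EFinP; exact: measurableT_comp.
  move=> yy _ /=; rewrite lee_fin /Dn.
  by have [] := leP 0%R (- D (S yy))%R; rewrite ?normr0 ?normrN.
have mul_int (g : Y * Y -> \bar R) (a : Y * Y -> R) :
    measurable_fun [set: Y * Y] a -> (forall yy, 0 <= a yy <= 1)%R ->
    P2.-integrable setT g ->
    P2.-integrable setT (fun yy => g yy * (a yy)%:E).
  move=> ma a01 ig; have [mg _] := integrableP _ _ _ ig.
  apply: le_integrable ig => //.
    by apply: emeasurable_funM => //; exact/measurable_EFinP.
  move=> yy _ /=; have /andP[a0 a1] := a01 yy.
  by rewrite abseM -[leRHS]mule1 lee_pmul//= lee_fin ger0_norm.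
have split_int (a : Y * Y -> R) :
    measurable_fun [set: Y * Y] a -> (forall yy, 0 <= a yy <= 1)%R ->
    \int[P2]_yy (D (S yy) * a yy)%:E =
    \int[P2]_yy ((Dp (S yy))%:E * (a yy)%:E) -
    \int[P2]_yy ((Dn (S yy))%:E * (a yy)%:E).
  move=> ma a01; rewrite -integralB//; [|exact: mul_int|exact: mul_int].
  by apply: eq_integral => yy _; rewrite DE mulrBl EFinB !EFinM.
have pbE : \int[P2]_yy (D (S yy) * p yy)%:E = \int[P2]_yy (D (S yy) * b yy)%:E.
  rewrite !split_int//; congr (_ - _).
  - apply: (ge0_integral_mul_comp P2 S mS p b (EFin \o Dp)) => //.
    + by move=> yy; have /andP[] := p01 yy.
    + by move=> yy; have /andP[] := b01 yy.
    + exact/measurable_EFinP.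
    + by move=> t; rewrite lee_fin le_max lexx orbT.
  - apply: (ge0_integral_mul_comp P2 S mS p b (EFin \o Dn)) => //.
    + by move=> yy; have /andP[] := p01 yy.
    + by move=> yy; have /andP[] := b01 yy.
    + exact/measurable_EFinP.
    + by move=> t; rewrite lee_fin le_max lexx orbT.
have ip := mul_int _ p mp p01 iD.
have ib := mul_int _ b mb b01 iD.
have bfin : \int[P2]_yy (D (S yy) * b yy)%:E \is a fin_num.
  rewrite (_ : (fun yy => _) = (fun yy => (D (S yy))%:E * (b yy)%:E))//.
  exact: integrable_fin_num.
transitivity (\int[P2]_yy ((D (S yy) * p yy)%:E - (D (S yy) * b yy)%:E)).
  apply: ae_eq_integral => //.
  - apply/measurable_EFinP; apply: measurable_funM.
      exact: measurable_funB.
    exact: measurableT_comp.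
  - by have [] := integrableP _ _ _ (integrableB measurableT ip ib).
  - by apply: filterS bq => yy /= E _; rewrite E -EFinB -mulrBr mulrC.
by rewrite integralB// pbE subee.
Qed.

End ConditionalExpectationOnPairs.

(** * Lower bound for the residual of the score in the embedded space *)

Section EmbeddedResidual.
Local Open Scope ereal_scope.
Context {R : realType} {dX dY : measure_display}.
Context {X : measurableType dX} {Y : measurableType dY} {d : nat}.
Variables (phi : {mfun (X * Y)%type >-> d.-tuple R}).
Variables (mu : X -> probability Y R) (x : X).
Local Notation T := (d.-tuple R).
Local Notation P := (mu x).
Local Notation P2 := (mu x \x mu x).
Local Notation S := (phi_at2 phi x).
Local Notation law2 := (embedded_law2 phi mu x).

Lemma measurable_phi_at2 : measurable_fun [set: Y * Y] S.
Proof.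
by apply: measurable_fun_pair; apply: measurableT_comp => //;
  exact: measurable_phi_at.
Qed.

(** [embedded_law2] is a product of pushforwards, so Tonelli is combined with one change of
    variables per factor. *)
Lemma integral_embedded_law2 (f : T * T -> \bar R) :
  measurable_fun [set: T * T] f -> (forall zz, 0 <= f zz) ->
  \int[law2]_zz f zz = \int[P2]_yy f (S yy).
Proof.
move=> mf f0.
have mf1 : measurable_fun [set: T]
    (fun z => \int[embedded_law phi mu x]_z' f (z, z')).
  exact: (measurable_fun_fubini_tonelli_F f).
rewrite (fubini_tonelli1 f)// (fubini_tonelli1 (f \o S))//=; last first.
  exact: measurableT_comp measurable_phi_at2.
rewrite /fubini_F ge0_integral_distribution//; last first.
  by move=> z; exact: integral_ge0.
apply: eq_integral => y _ /=.
rewrite ge0_integral_distribution//.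
exact: measurableT_comp.
Qed.

Lemma Lfun2_embedded (f : T * T -> R) : measurable_fun [set: T * T] f ->
  f \in Lfun law2 2%:E <-> f \o S \in Lfun P2 2%:E.
Proof.
move=> mf.
have E : \int[law2]_zz (f zz ^+ 2)%:E = \int[P2]_yy (f (S yy) ^+ 2)%:E.
  rewrite (integral_embedded_law2 (fun zz => (f zz ^+ 2)%:E))//.
    by apply/measurable_EFinP; exact: measurable_funX.
  by move=> zz; rewrite lee_fin sqr_ge0.
split=> /Lfun2P[_ h]; apply/Lfun2P; split => //.
- exact: measurableT_comp measurable_phi_at2.
- by rewrite -E.
- by rewrite E.
Qed.

Lemma Lnorm2_embedded (f : T * T -> R) : measurable_fun [set: T * T] f ->
  'N[law2]_2%:E[EFin \o f] ^+ 2 = \int[P2]_yy (f (S yy) ^+ 2)%:E.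
Proof.
move=> mf; rewrite Lnorm2E (integral_embedded_law2 (fun zz => (f zz ^+ 2)%:E))//.
  by apply/measurable_EFinP; exact: measurable_funX.
by move=> zz; rewrite lee_fin sqr_ge0.
Qed.

(** The potential [h] is arbitrary, with no regularity given. Its pullback [c] nevertheless differs
    by a constant from a slice of [a] with second response fixed, and some slice is square
    integrable. *)
Lemma difference_space_pullback (a : T * T -> R) :
  difference_space phi mu x a ->
  exists2 c : Y -> R, c \in Lfun P 2%:E & a \o S =1 difference c.
Proof.
move=> [aL [h ah]].
have /Lfun2P[ma _] := aL.
have /(Lfun2_embedded _ ma)/Lfun2P[maS aS2] := aL.
pose c y := h (phi_at phi x y).
have aSE yy : a (S yy) = difference c yy by rewrite ah//; exists yy.1 + exists yy.2.
exists c => //.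
(* If every slice had infinite energy, Tonelli would make the whole energy of [a] infinite. *)
have [y0 y0P] : exists y', \int[P]_y ((a (S (y, y'))) ^+ 2)%:E < +oo.
  apply: contrapT => /forallNP noo.
  move: aS2; rewrite (fubini_tonelli2 (fun yy => (a (S yy) ^+ 2)%:E))/=.
  - rewrite /fubini_G (eq_integral (cst +oo)); last first.
      by move=> y' _; have /negP := noo y'; rewrite -leNgt leye_eq => /eqP.
    by rewrite integral_cst// [X in _ * X]probability_setT mule1.
  - by apply/measurable_EFinP; exact: measurable_funX.
  - by move=> yy; rewrite lee_fin sqr_ge0.
have aL0 : (fun y => a (S (y, y0))) \in Lfun P 2%:E.
  by apply/Lfun2P; split => //; exact: (measurableT_comp maS).
have -> : c = ((fun y => a (S (y, y0))) \- cst (- c y0))%R.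
  by apply/funext => y; rewrite /= aSE /difference/= opprK subrK.
by apply: Lfun2B => //; exact: Lfun_cst.
Qed.

Lemma Lnorm2_le d1 d2 (U1 : measurableType d1) (U2 : measurableType d2)
    (m1 : {measure set U1 -> \bar R}) (m2 : {measure set U2 -> \bar R})
    (f : U1 -> R) (g : U2 -> R) :
  \int[m1]_t (f t ^+ 2)%:E <= \int[m2]_t (g t ^+ 2)%:E ->
  'N[m1]_2%:E[EFin \o f] <= 'N[m2]_2%:E[EFin \o g].
Proof.
rewrite -!Lnorm2E.
set a := 'N[m1]_2%:E[EFin \o f]; set b := 'N[m2]_2%:E[EFin \o g].
have a0 : 0 <= a by exact: Lnorm_ge0.
have b0 : 0 <= b by exact: Lnorm_ge0.
move: a b a0 b0 => [a| |] [b| |]//; rewrite ?leey// !lee_fin => a0 b0.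
by rewrite -!expr2 ler_pXn2r.
Qed.

Section Bound.
Variable W : T * T -> R.
Hypothesis mW : measurable_fun [set: T * T] W.
Hypothesis anti : {ae P2, forall yy, W (S (unstable.swap yy)) = (- W (S yy))%R}.

(** At [z = phi_at phi x y] this is [row_mean] of the pulled-back kernel at [y]; being defined at
    every [z], it can serve as a score head. *)
Definition embedded_row_mean (z : T) : R :=
  fine (\int[P]_y' (W (z, phi_at phi x y'))%:E).

Let D zz := (W zz - (embedded_row_mean zz.1 - embedded_row_mean zz.2))%R.

(** An element of the closure is within [e] of a true difference, to which [row_mean_minimal]
    applies; Minkowski transfers the bound to [v] up to [e], which is arbitrary. *)
Let WL_residual_le v : W \o S \in Lfun P2 2%:E -> score_space phi mu x v ->
  \int[P2]_yy (D (S yy) ^+ 2)%:E <= 'N[law2]_2%:E[EFin \o (W \- v)%R] ^+ 2.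
Proof.
move=> WL [vL vV].
have /Lfun2P[mv _] := vL.
have mWv : measurable_fun [set: T * T] (W \- v)%R by exact: measurable_funB.
pose A := 'N[P2]_2%:E[EFin \o (D \o S)].
have AE : \int[P2]_yy (D (S yy) ^+ 2)%:E = A ^+ 2 by rewrite Lnorm2E.
have A0 : 0 <= A by exact: Lnorm_ge0.
have B0 : 0 <= 'N[law2]_2%:E[EFin \o (W \- v)%R] by exact: Lnorm_ge0.
rewrite AE; suff AB : A <= 'N[law2]_2%:E[EFin \o (W \- v)%R].
  by rewrite !expe2 lee_pmul.
apply/lee_addgt0Pr => e e0.
have [a aD va] := vV e e0.
have [c cL ac] := difference_space_pullback _ aD.
have /Lfun2P[ma _] := proj1 aD.
have mWa : measurable_fun [set: T * T] (W \- a)%R by exact: measurable_funB.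
have Aa : A <= 'N[law2]_2%:E[EFin \o (W \- a)%R].
  apply: Lnorm2_le; rewrite -[leRHS]Lnorm2E Lnorm2_embedded//.
  have mWS : measurable_fun [set: Y * Y] (W \o S).
    exact: measurableT_comp measurable_phi_at2.
  apply: le_trans (row_mean_minimal P (W \o S) mWS WL anti c cL) _.
  by under eq_integral do rewrite -ac.
apply: (le_trans Aa).
have -> : (W \- a = (W \- v) \+ (v \- a))%R.
  by apply/funext => zz /=; rewrite addrA subrK.
apply: (@le_trans _ _ ('N[law2]_2%:E[EFin \o (W \- v)%R] +
    'N[law2]_2%:E[EFin \o (v \- a)%R])).
  apply: minkowski_EFin => //; first exact: measurable_funB.
  by rewrite ler1n.
by rewrite leeD2l// ltW.
Qed.

(** If [W] has infinite energy, so does [W - v], because [v] is square integrable; the value [+oo]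
    on the left is then matched on the right. *)
Lemma score_space_residual_ge v : score_space phi mu x v ->
  (if \int[P2]_yy (W (S yy) ^+ 2)%:E < +oo
   then \int[P2]_yy (D (S yy) ^+ 2)%:E else +oo) <=
  'N[law2]_2%:E[EFin \o (W \- v)%R] ^+ 2.
Proof.
move=> vV; have mWS : measurable_fun [set: Y * Y] (W \o S).
  exact: measurableT_comp measurable_phi_at2.
case: ifPn => [W2|Woo].
  by apply: WL_residual_le => //; apply/Lfun2P.
rewrite leye_eq; apply: contraNT Woo; rewrite -ltey Lnorm2E => Wv2.
have [vL _] := vV; have /Lfun2P[mv _] := vL.
have WvL : (W \- v)%R \in Lfun law2 2%:E.
  by apply/Lfun2P; split => //; exact: measurable_funB.
have L0 : cst 0%R \in Lfun law2 2%:E.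
  apply/Lfun2P; split => //.
  by under eq_integral do rewrite /= expr0n; rewrite integral0.
suff /(Lfun2_embedded _ mW)/Lfun2P[_] : W \in Lfun law2 2%:E by [].
have -> : W = ((W \- v) \- (cst 0 \- v))%R.
  by apply/funext => zz /=; rewrite sub0r opprK subrK.
by apply: Lfun2B => //; exact: Lfun2B.
Qed.

Lemma score_space0 : score_space phi mu x (cst 0%R).
Proof.
have L0 : cst 0%R \in Lfun law2 2%:E.
  apply/Lfun2P; split => //.
  by under eq_integral do rewrite /= expr0n; rewrite integral0.
split => // e e0; exists (cst 0%R).
  by split => //; exists (cst 0%R) => z z' _ _; rewrite subrr.
rewrite (_ : EFin \o _ = cst 0) ?Lnorm0//.
by apply/funext => zz /=; rewrite subrr.
Qed.

(* The junk value of [L2_proj] is [0], which lies in the score space too, so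
   the existence of the projection need not be established. *)
Lemma L2_proj_residual_ge :
  (if \int[P2]_yy (W (S yy) ^+ 2)%:E < +oo
   then \int[P2]_yy (D (S yy) ^+ 2)%:E else +oo) <=
  'N[law2]_2%:E[EFin \o (W \- L2_proj law2 (score_space phi mu x) W)%R] ^+ 2.
Proof.
apply: score_space_residual_ge; rewrite /L2_proj.
by case: xgetP => [v _ []|_]//; exact: score_space0.
Qed.

End Bound.
End EmbeddedResidual.

(** * Measurability of the logistic functions *)

Section MeasurableModel.
Context {R : realType}.

(* With the convention 0^-1 = 0, inversion agrees everywhere with the measurable
   function x * (x^2) `^ (-1). *)
Lemma measurable_invr : measurable_fun [set: R] (@GRing.inv R).
Proof.
have -> : @GRing.inv R = (fun x => x * (x ^+ 2) `^ (-1)).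
  apply/funext => x; rewrite powR_inv1 ?sqr_ge0//.
  have [->|x0] := eqVneq x 0; first by rewrite invr0 mul0r.
  by rewrite expr2 invfM mulrA divff// mul1r.
apply: measurable_funM => //.
exact: (measurableT_comp (measurable_powR _)).
Qed.

Lemma measurable_sigmoid : measurable_fun [set: R] (@sigmoid R).
Proof.
apply: continuous_measurable_fun => t.
apply/differentiable_continuous/derivable1_diffP.
by case: (is_derive_sigmoid t).
Qed.

Lemma measurable_logit : measurable_fun [set: R] (@logit R).
Proof.
apply: measurableT_comp; first exact: measurable_ln.
apply: measurable_funM => //.
apply: (measurableT_comp measurable_invr).
exact: measurable_funB.
Qed.

Lemma logit_onem (p : R) : 0 < p < 1 -> logit (1 - p) = - logit p.
Proof.
move=> /andP[p0 p1]; have q0 : 0 < 1 - p by rewrite subr_gt0.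
by rewrite /logit subKr -lnV ?posrE ?divr_gt0// invf_div.
Qed.

Context {d : measure_display} {T : measurableType d}.

Lemma measurable_cross_entropy (f g : T -> R) :
  measurable_fun [set: T] f -> measurable_fun [set: T] g ->
  measurable_fun [set: T] (fun t => cross_entropy (f t) (g t)).
Proof.
move=> mf mg; apply: measurable_funB; apply: measurable_funM.
- exact: measurableT_comp.
- by apply: measurableT_comp => //; exact: measurable_ln.
- exact: measurable_funB.
- by apply: measurableT_comp; [exact: measurable_ln|exact: measurable_funB].
Qed.

End MeasurableModel.

(** * Symmetry and range of the pooled win probability *)

Section PooledWin.
Context {R : realType} {dX dY : measure_display}.
Context {X : measurableType dX} {Y : measurableType dY} {n : nat}.
Hypothesis n_gt0 : (0 < n)%N.
Variable u : 'I_n -> {mfun (X * Y)%type >-> R}.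

Lemma pooled_win_swap x y y' : pooled_win u x y' y = 1 - pooled_win u x y y'.
Proof.
have n0 : n%:R != 0 :> R by rewrite pnatr_eq0 -lt0n.
rewrite /pooled_win.
under eq_bigr do rewrite -opprB -onem_sigmoid.
rewrite sumrB sumr_const card_ord mulrBr; congr (_ - _).
by rewrite div1r mulVf.
Qed.

Lemma pooled_win_gt0 x y y' : 0 < pooled_win u x y y'.
Proof.
rewrite /pooled_win mulr_gt0 ?div1r ?invr_gt0 ?ltr0n//.
case: n n_gt0 u => // m _ v; rewrite big_ord_recl ltr_pwDl ?sigmoid_gt0//.
by apply: sumr_ge0 => i _; rewrite ltW// sigmoid_gt0.
Qed.

Lemma pooled_win_itv x y y' : 0 < pooled_win u x y y' < 1.
Proof.
by rewrite pooled_win_gt0 -subr_gt0 -pooled_win_swap pooled_win_gt0.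
Qed.

Lemma measurable_pooled_win : measurable_fun [set: X * (Y * Y)]
  (fun z => pooled_win u z.1 z.2.1 z.2.2).
Proof.
apply: measurable_funM => //; apply: measurable_sum => i.
apply: (measurableT_comp measurable_sigmoid); apply: measurable_funB.
- apply: measurableT_comp => //; apply: measurable_fun_pair => //.
  exact: measurableT_comp.
- apply: measurableT_comp => //; apply: measurable_fun_pair => //.
  exact: measurableT_comp.
Qed.

End PooledWin.

(** * The loss bound on one probability space of response pairs *)

Section FixedPrompt.
Local Open Scope ereal_scope.
Context {R : realType} {d : measure_display} {Om : measurableType d}.
Variable P : probability Om R.

(* Integrate [cross_entropy_excess_le]: the first-order term
   (p - s) * D drops out because it has mean zero. *)
Lemma integral_cross_entropy_le (p s D : Om -> R) :
  measurable_fun [set: Om] p -> measurable_fun [set: Om] s ->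
  (forall w, 0 < p w < 1)%R -> {ae P, forall w, 0 < s w < 1}%R ->
  D \in Lfun P 2%:E -> \int[P]_w ((p w - s w) * D w)%:E = 0 ->
  \int[P]_w (cross_entropy (p w) (sigmoid (logit (s w) + D w)))%:E <=
  \int[P]_w (cross_entropy (p w) (p w))%:E +
  \int[P]_w `|(p w - s w) ^+ 2 / (s w * (1 - s w))|%:E +
  (1 / 8)%:E * \int[P]_w ((D w) ^+ 2)%:E.
Proof.
move=> mp ms p01 s01 DL orth.
have /Lfun2P[mD D2] := DL.
have p01' w : (0 <= p w <= 1)%R by have /andP[/ltW-> /ltW->] := p01 w.
(* The quotient can be negative on the null set where [s] leaves the unit interval; the absolute
   value makes it nonnegative everywhere. *)
pose chi w := `|(p w - s w) ^+ 2 / (s w * (1 - s w))|%R.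
have mpsD : measurable_fun [set: Om] (fun w => (p w - s w)%R).
  exact: measurable_funB.
have mchi : measurable_fun [set: Om] chi.
  apply: measurableT_comp => //; apply: measurable_funM.
    exact: measurable_funX.
  apply: (measurableT_comp measurable_invr); apply: measurable_funM => //.
  exact: measurable_funB.
have mH : measurable_fun [set: Om] (fun w => cross_entropy (p w) (p w)).
  exact: measurable_cross_entropy.
have mL : measurable_fun [set: Om]
    (fun w => cross_entropy (p w) (sigmoid (logit (s w) + D w))).
  apply: measurable_cross_entropy => //.
  apply: (measurableT_comp measurable_sigmoid); apply: measurable_funD => //.
  exact: measurableT_comp measurable_logit ms.
have H0 w : (0 <= cross_entropy (p w) (p w))%R by exact: cross_entropy_ge0.
(* With an infinite chi-square term the bound is trivial; otherwise all terms on the right are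
   integrable. *)
have [chioo|] := eqVneq (\int[P]_w (chi w)%:E) +oo.
  rewrite chioo addey; last first.
    by rewrite gt_eqF// (lt_le_trans _ (integral_ge0 _ _))// => w _; rewrite lee_fin.
  rewrite addye ?leey// gt_eqF// (@lt_le_trans _ _ 0)// mule_ge0//.
  by apply: integral_ge0 => w _; rewrite lee_fin sqr_ge0.
rewrite -ltey => chi_fin.
have Hi : P.-integrable setT (fun w => (cross_entropy (p w) (p w))%:E).
  apply: (@le_integrable _ _ _ P _ measurableT _ (EFin \o cst 1%R)).
  - exact/measurable_EFinP.
  - move=> w _ /=; rewrite lee_fin normr1 ger0_norm//.
    exact: entropy_le1.
  - exact: probability_integrable_cst.
have chii : P.-integrable setT (fun w => (chi w)%:E).
  apply/integrableP; split; first exact/measurable_EFinP.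
  by under eq_integral do rewrite /= /chi normr_id.
have D2i : P.-integrable setT (fun w => (1 / 8)%:E * (D w ^+ 2)%:E).
  by apply: integrableZl => //; exact: Lfun2_integrable_sqr.
have Di : P.-integrable setT (EFin \o D) by exact: Lfun2_integrable.
have mpsDD : measurable_fun [set: Om] (fun w => ((p w - s w) * D w)%:E).
  by apply/measurable_EFinP; exact: measurable_funM.
(* Both probabilities lie in the unit interval almost everywhere, so this term is dominated by
   [D]. *)
have psDi : P.-integrable setT (fun w => ((p w - s w) * D w)%:E).
  have [mED Dfin] := integrableP _ _ _ Di.
  apply/integrableP; split => //; apply: le_lt_trans Dfin.
  apply: ae_ge0_le_integral => //.
  - exact: measurableT_comp.
  - exact: measurableT_comp.
  apply: filterS s01 => w /= /andP[s0 s1] _.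
  have /andP[p0 p1] := p01 w.
  rewrite lee_fin normrM ler_piMl// ler_norml; lra.
pose f w := (cross_entropy (p w) (p w))%:E + (chi w)%:E +
  (1 / 8)%:E * (D w ^+ 2)%:E - ((p w - s w) * D w)%:E.
have HCi := integrableD measurableT Hi chii.
have HCDi := integrableD measurableT HCi D2i.
have fi : P.-integrable setT f by exact: integrableB.
have mf : measurable_fun [set: Om] f by have [] := integrableP _ _ _ fi.
have le_f : {ae P, forall w,
    (cross_entropy (p w) (sigmoid (logit (s w) + D w)))%:E <= f w}.
  apply: filterS s01 => w s01w.
  have := cross_entropy_excess_le (p w) (s w) (logit (s w) + D w) (p01 w) s01w.
  have -> : (logit (s w) + D w - logit (s w) = D w)%R by rewrite addrC addKr.
  have /andP[s0 s1] := s01w.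
  rewrite -[X in (_ + X + _)%R](ger0_norm (_ : 0 <= _)%R); last first.
    by rewrite divr_ge0 ?sqr_ge0// mulr_ge0 ?subr_ge0 ?ltW.
  rewrite -/(chi w) /f -EFinM -!EFinD lee_fin; move: (chi w) => c; lra.
have -> : \int[P]_w (cross_entropy (p w) (p w))%:E + \int[P]_w (chi w)%:E +
    (1 / 8)%:E * \int[P]_w ((D w) ^+ 2)%:E = \int[P]_w f w.
  rewrite /f integralB// orth sube0 integralD// integralD// integralZl//.
  exact: Lfun2_integrable_sqr.
(* [f] dominates the nonnegative loss almost everywhere, hence is nonnegative there; [|f|] is a
   nonnegative version of it, as monotonicity requires. *)
have -> : \int[P]_w f w = \int[P]_w `|f w|.
  apply: ae_eq_integral => //; first exact: measurableT_comp.
  apply: filterS le_f => w fw _; rewrite gee0_abs//.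
  by apply: le_trans fw; rewrite lee_fin cross_entropy_ge0// sigmoid_gt0 sigmoid_lt1.
apply: ae_ge0_le_integral => //.
- by move=> w _; rewrite lee_fin cross_entropy_ge0// sigmoid_gt0 sigmoid_lt1.
- exact/measurable_EFinP.
- exact: measurableT_comp.
- by apply: filterS le_f => w fw _; exact: le_trans (lee_abs _).
Qed.

End FixedPrompt.

(** * The explicit head and its loss at one prompt *)

Section Assembly.
Local Open Scope ereal_scope.
Context {R : realType} {dX dY : measure_display}.
Context {X : measurableType dX} {Y : measurableType dY} {n d : nat}.
Variables (u : 'I_n -> {mfun (X * Y)%type >-> R}).
Variable phi : {mfun (X * Y)%type >-> d.-tuple R}.
Variable q : {mfun (X * (d.-tuple R * d.-tuple R))%type >-> R}.
Variable mu : X -> probability Y R.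
Local Notation T := (d.-tuple R).
Local Notation W := (embedded_score q).
Local Notation S := (phi_at2 phi).
Hypothesis n_gt0 : (0 < n)%N.

Definition score_head (xz : X * T) : R :=
  embedded_row_mean phi mu xz.1 (W xz.1) xz.2.

Definition head_residual x zz : R :=
  (W x zz - (score_head (x, zz.1) - score_head (x, zz.2)))%R.

Lemma measurable_embedded_score :
  measurable_fun [set: X * (T * T)] (fun z => W z.1 z.2).
Proof.
apply: (measurableT_comp measurable_logit).
by apply: measurableT_comp => //; exact: measurable_fun_pair.
Qed.

Lemma measurable_embedded_score_at x : measurable_fun [set: T * T] (W x).
Proof.
apply: (measurableT_comp measurable_logit).
exact: (measurableT_comp (measurable_funPT q) (pair1_measurable x)).
Qed.

Hypothesis hmu :
  forall A, measurable A -> measurable_fun [set: X] (fun x => mu x A).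

Lemma measurable_score_head : measurable_fun [set: X * T] score_head.
Proof.
apply: measurableT_comp => //.
apply: (measurable_integral_kernel_comp_sign mu hmu fst
  (fun z => (W z.1.1 (z.1.2, phi (z.1.1, z.2)))%:E)) => //.
apply/measurable_EFinP; apply: (measurableT_comp measurable_logit).
apply: (measurableT_comp (measurable_funPT q)).
apply: measurable_fun_pair; first exact: measurableT_comp.
apply: measurable_fun_pair; first exact: measurableT_comp.
apply: measurableT_comp => //.
by apply: measurable_fun_pair => //; exact: measurableT_comp.
Qed.

Lemma measurable_head_residual :
  measurable_fun [set: X * (T * T)] (fun z => head_residual z.1 z.2).
Proof.
apply: measurable_funB; first exact: measurable_embedded_score.
apply: measurable_funB; apply: (measurableT_comp measurable_score_head).
- by apply: measurable_fun_pair => //; exact: measurableT_comp.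
- by apply: measurable_fun_pair => //; exact: measurableT_comp.
Qed.

Lemma measurable_phi_at2_uncurried :
  measurable_fun [set: X * (Y * Y)] (fun z => (z.1, S z.1 z.2)).
Proof.
apply: measurable_fun_pair => //; apply: measurable_fun_pair;
  apply: measurableT_comp => //; apply: measurable_fun_pair => //;
  exact: measurableT_comp.
Qed.

Section AtPrompt.
Variable x : X.
Local Notation P2 := (mu x \x mu x).
Hypothesis qx : is_cond_expectation P2 (S x)
  (fun yy => pooled_win u x yy.1 yy.2) (fun zz => q (x, zz)).
Hypothesis q01 : {ae P2, forall yy,
  (0 < induced_win phi q x yy.1 yy.2 < 1)%R}.

Let mp : measurable_fun [set: Y * Y] (fun yy => pooled_win u x yy.1 yy.2).
Proof.
exact: (measurableT_comp (measurable_pooled_win u) (pair1_measurable x)).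
Qed.

Let p01 yy : (0 <= pooled_win u x yy.1 yy.2 <= 1)%R.
Proof. by have /andP[/ltW-> /ltW->] := pooled_win_itv n_gt0 u x yy.1 yy.2. Qed.

(** Exchanging the responses turns [q] into [1 - q] almost everywhere, and [logit] turns this into a
    change of sign. *)
Lemma embedded_score_antisymmetric :
  {ae P2, forall yy, W x (S x (unstable.swap yy)) = (- W x (S x yy))%R}.
Proof.
have anti := cond_expectation_onem_swap (mu x) (phi_at phi x)
  (measurable_phi_at phi x) _ _ mp p01 qx.
have /anti qE : forall yy : Y * Y,
    (pooled_win u x (unstable.swap yy).1 (unstable.swap yy).2 =
     1 - pooled_win u x yy.1 yy.2)%R.
  by move=> yy; exact: pooled_win_swap.
apply: filterS2 q01 qE => yy q01yy qE.
by rewrite /embedded_score qE logit_onem.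
Qed.

Let score_energy := \int[P2]_yy (W x (S x yy) ^+ 2)%:E.

(** A measurable substitute, as a function of the prompt, for the squared norm of [score_residual],
    from which it differs in that no projection is chosen. The value [+oo] covers scores outside
    L^2. *)
Definition residual_energy : \bar R :=
  if score_energy < +oo
  then \int[P2]_yy (head_residual x (S x yy) ^+ 2)%:E else +oo.

Lemma residual_energy_le : residual_energy <=
  'N[embedded_law2 phi mu x]_2%:E[EFin \o score_residual phi q mu x] ^+ 2.
Proof.
apply: L2_proj_residual_ge; first exact: measurable_embedded_score_at.
exact: embedded_score_antisymmetric.
Qed.

Lemma residual_energy_ge0 : 0 <= residual_energy.
Proof.
rewrite /residual_energy; case: ifPn => // _.
by apply: integral_ge0 => yy _; rewrite lee_fin sqr_ge0.
Qed.

(** A prompt with a score outside L^2 has an infinite right-hand side. Otherwise the residual is a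
    square-integrable function of the embedded pair, so [cond_expectation_orthogonal] and the loss
    bound apply. *)
Lemma prompt_loss_le :
  \int[P2]_yy (cross_entropy (pooled_win u x yy.1 yy.2)
    (sigmoid (score_head (x, phi (x, yy.1)) - score_head (x, phi (x, yy.2)))))%:E <=
  \int[P2]_yy (cross_entropy (pooled_win u x yy.1 yy.2)
    (pooled_win u x yy.1 yy.2))%:E +
  \int[P2]_yy `|(pooled_win u x yy.1 yy.2 - induced_win phi q x yy.1 yy.2) ^+ 2 /
    kappa phi q x yy.1 yy.2|%:E + (1 / 8)%:E * residual_energy.
Proof.
have mWS : measurable_fun [set: Y * Y] (W x \o S x).
  apply: measurableT_comp (measurable_phi_at2 phi x).
  exact: measurable_embedded_score_at.
rewrite /residual_energy; case: ifPn => [W2|_]; last first.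
  rewrite gt0_muley ?lte_fin// addey ?leey// gt_eqF//.
  rewrite (@lt_le_trans _ _ 0)// adde_ge0// integral_ge0// => yy _; rewrite lee_fin//.
  exact/cross_entropy_ge0/pooled_win_itv.
have WL : W x \o S x \in Lfun P2 2%:E by exact/Lfun2P.
have DL : head_residual x \o S x \in Lfun P2 2%:E.
  exact: (Lfun2_row_residual (mu x) (W x \o S x) mWS WL).
have mD : measurable_fun [set: T * T] (fun zz => - head_residual x zz)%R.
  apply: measurableT_comp => //.
  exact: (measurableT_comp measurable_head_residual (pair1_measurable x)).
(* With this sign, the score plus [D] is exactly the reward gap of the head. *)
pose D yy := (- head_residual x (S x yy))%R.
have D2E yy : (D yy ^+ 2 = head_residual x (S x yy) ^+ 2)%R by rewrite sqrrN.
have DL' : D \in Lfun P2 2%:E.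
  have /Lfun2P[_ h2] := DL; apply/Lfun2P; split.
    exact: measurableT_comp mD (measurable_phi_at2 phi x).
  by under eq_integral do rewrite D2E.
have orth : \int[P2]_yy ((pooled_win u x yy.1 yy.2 -
    induced_win phi q x yy.1 yy.2) * D yy)%:E = 0.
  apply: (cond_expectation_orthogonal (mu x) (phi_at phi x)
    (measurable_phi_at phi x) _ _ mp p01 qx
    (fun zz => - head_residual x zz)%R) => //.
  - by apply: filterS q01 => yy /andP[/ltW q0 /ltW q1]; exact/andP.
  - exact: Lfun2_integrable DL'.
have ms : measurable_fun [set: Y * Y]
    (fun yy => induced_win phi q x yy.1 yy.2).
  exact: (measurableT_comp (measurableT_comp (measurable_funPT q)
    (pair1_measurable x)) (measurable_phi_at2 phi x)).
have := integral_cross_entropy_le P2 _ _ _ mp ms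
  (fun yy => pooled_win_itv n_gt0 u x yy.1 yy.2) q01 DL' orth.
have -> : \int[P2]_yy (D yy ^+ 2)%:E =
    \int[P2]_yy (head_residual x (S x yy) ^+ 2)%:E.
  by apply: eq_integral => yy _; rewrite D2E.
apply: le_trans; rewrite le_eqVlt; apply/orP; left; apply/eqP.
apply: eq_integral => yy _; congr ((cross_entropy _ (sigmoid _))%:E).
by rewrite -[logit _]/(W x (S x yy)) /D /head_residual opprB addrCA subrr addr0.
Qed.

End AtPrompt.

Lemma measurable_residual_energy : measurable_fun [set: X] residual_energy.
Proof.
have mS := measurable_phi_at2_uncurried.
have msq (k : X * (T * T) -> R) : measurable_fun [set: X * (T * T)] k ->
    measurable_fun [set: X] (fun x => \int[mu x \x mu x]_yy
      (k (x, S x yy) ^+ 2)%:E).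
  move=> mk; apply: (measurable_integral_kernel2 mu hmu
    (fun z => (k (z.1, S z.1 z.2) ^+ 2)%:E)).
    apply/measurable_EFinP; apply: measurable_funX.
    exact: (measurableT_comp mk mS).
  by move=> z; rewrite lee_fin sqr_ge0.
apply: measurable_fun_ifT => //.
- have mW2 := msq (fun z => W z.1 z.2).
  apply: (measurable_fun_bool true).
  rewrite [X in measurable (_ `&` X)](_ : _ = [set x |
    \int[mu x \x mu x]_yy (W x (S x yy) ^+ 2)%:E < +oo])//.
  apply: measurable_lte => //; apply: mW2.
  exact: measurable_embedded_score.
- exact: (msq (fun z => head_residual z.1 z.2) measurable_head_residual).
Qed.

End Assembly.

(** * Integration over the prompts *)

Theorem theoremB1 (R : realType) (dX dY : measure_display)
    (X : measurableType dX) (Y : measurableType dY)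
    (nu : probability X R) (mu : X -> probability Y R)
    (hmu : forall A : set Y, measurable A ->
       measurable_fun [set: X] (fun x => mu x A))
    (n : nat) (hn : (0 < n)%N) (u : 'I_n -> {mfun (X * Y)%type >-> R})
    (d : nat) (phi : {mfun (X * Y)%type >-> d.-tuple R})
    (q : {mfun (X * (d.-tuple R * d.-tuple R))%type >-> R})
    (hq : is_induced_win phi u nu mu q)
    (hq01 : {ae nu, forall x, {ae (mu x \x mu x)%E, forall yy,
       0 < induced_win phi q x yy.1 yy.2 < 1}})
    (eps : R) (heps : 0 < eps) :
  exists g : {mfun (X * d.-tuple R)%type >-> R},
    (loss u nu mu (fun xy => g (xy.1, phi xy)) - bayes_loss u nu mu <=
     \int[nu]_x \int[mu x \x mu x]_yy
       ((pooled_win u x yy.1 yy.2 - induced_win phi q x yy.1 yy.2) ^+ 2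
        / kappa phi q x yy.1 yy.2)%R%:E
     + (1 / 8)%R%:E * \int[nu]_x
         ('N[embedded_law2 phi mu x]_(2%:E)
            [EFin \o score_residual phi q mu x] ^+ 2)
     + eps%:E)%E.
Proof.
have mscore := measurable_embedded_score_at q.
have mhead := measurable_score_head phi q mu hmu.
have mpw := measurable_pooled_win u.
have mphi2 := measurable_phi_at2_uncurried phi.
have mq2 : measurable_fun [set: X * (Y * Y)]
    (fun z => induced_win phi q z.1 z.2.1 z.2.2).
  exact: (measurableT_comp (measurable_funPT q) mphi2).
pose g0 := isMeasurableFun.Build _ _ _ _ (score_head phi q mu) mhead.
pose g : {mfun (X * d.-tuple R)%type >-> R} := HB.pack (score_head phi q mu) g0.
exists g.
pose gain z := g (z.1, phi (z.1, z.2.1)) - g (z.1, phi (z.1, z.2.2)).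
have mgain : measurable_fun [set: X * (Y * Y)] gain.
  apply: measurable_funB; apply: (measurableT_comp mhead);
    apply: measurable_fun_pair => //; apply: measurableT_comp => //;
    apply: measurable_fun_pair => //; exact: measurableT_comp.
pose p z := pooled_win u z.1 z.2.1 z.2.2.
pose s z := induced_win phi q z.1 z.2.1 z.2.2.
have p01 z : 0 < p z < 1 by exact: pooled_win_itv.
have p01' z : 0 <= p z <= 1 by have /andP[/ltW-> /ltW->] := p01 z.
pose chi z := (p z - s z) ^+ 2 / (s z * (1 - s z)).
have mchi : measurable_fun [set: X * (Y * Y)] chi.
  apply: measurable_funM; first by apply: measurable_funX; exact: measurable_funB.
  apply: (measurableT_comp measurable_invr).
  by apply: measurable_funM => //; exact: measurable_funB.
pose L x := (\int[mu x \x mu x]_yy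
  (cross_entropy (p (x, yy)) (sigmoid (gain (x, yy))))%:E)%E.
pose H x := (\int[mu x \x mu x]_yy (cross_entropy (p (x, yy)) (p (x, yy)))%:E)%E.
pose C x := (\int[mu x \x mu x]_yy (chi (x, yy))%:E)%E.
pose AC x := (\int[mu x \x mu x]_yy `|chi (x, yy)|%:E)%E.
pose N := residual_energy phi q mu.
have L0 z : 0 <= cross_entropy (p z) (sigmoid (gain z)).
  by rewrite cross_entropy_ge0// sigmoid_gt0 sigmoid_lt1.
have H0 z : 0 <= cross_entropy (p z) (p z) by exact: cross_entropy_ge0.
have mL : measurable_fun [set: X] L.
  apply: (measurable_integral_kernel2 mu hmu
    (fun z => (cross_entropy (p z) (sigmoid (gain z)))%:E)) => //.
  apply/measurable_EFinP; apply: measurable_cross_entropy => //.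
  exact: (measurableT_comp measurable_sigmoid).
have mH : measurable_fun [set: X] H.
  apply: (measurable_integral_kernel2 mu hmu
    (fun z => (cross_entropy (p z) (p z))%:E)) => //.
  by apply/measurable_EFinP; exact: measurable_cross_entropy.
have mAC : measurable_fun [set: X] AC.
  apply: (measurable_integral_kernel2 mu hmu (fun z => `|chi z|%:E)) => //.
  by apply/measurable_EFinP; exact: measurableT_comp.
have mC : measurable_fun [set: X] C.
  apply: (measurable_integral_kernel2_sign mu hmu (EFin \o chi)).
  exact/measurable_EFinP.
have mN : measurable_fun [set: X] N by exact: measurable_residual_energy.
have N0 x : (0 <= N x)%E by exact: residual_energy_ge0.
have iL0 x : (0 <= L x)%E by apply: integral_ge0 => yy _; rewrite lee_fin.
have iH0 x : (0 <= H x)%E by apply: integral_ge0 => yy _; rewrite lee_fin.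
have iAC0 x : (0 <= AC x)%E by apply: integral_ge0 => yy _; rewrite lee_fin.
have LE : loss u nu mu (fun xy => g (xy.1, phi xy)) = (\int[nu]_x L x)%E by [].
have HE : bayes_loss u nu mu = (\int[nu]_x H x)%E by [].
have CE : (\int[nu]_x \int[mu x \x mu x]_yy
    ((pooled_win u x yy.1 yy.2 - induced_win phi q x yy.1 yy.2) ^+ 2
     / kappa phi q x yy.1 yy.2)%R%:E)%E = (\int[nu]_x C x)%E by [].
rewrite LE HE CE.
(* The entropy bound makes the Bayes loss finite, which lets it be moved across the inequality in
   the extended reals. *)
have H_le1 x : (H x <= 1)%E.
  rewrite -(@probability_setT _ _ _ (mu x \x mu x)%E) -[leRHS]mul1e.
  rewrite -integral_cst//; apply: ge0_le_integral_nonmeasurable => yy.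
    by rewrite lee_fin.
  by rewrite lee_fin; exact: entropy_le1.
have Hfin : (\int[nu]_x H x)%E \is a fin_num.
  rewrite ge0_fin_numE ?integral_ge0//.
  apply: (@le_lt_trans _ _ 1%E); last by rewrite ltry.
  rewrite -(@probability_setT _ _ _ nu) -[leRHS]mul1e -integral_cst//.
  exact: ge0_le_integral_nonmeasurable.
(* The absolute value changes nothing where the induced probability lies in the open unit interval,
   that is, almost everywhere. *)
have ACE : (\int[nu]_x AC x = \int[nu]_x C x)%E.
  apply: ae_eq_integral => //.
  apply: filterS hq01 => x sx _; apply: ae_eq_integral => //.
  - apply/measurable_EFinP; apply: measurableT_comp => //.
    exact: (measurableT_comp mchi (pair1_measurable x)).
  - apply/measurable_EFinP.
    exact: (measurableT_comp mchi (pair1_measurable x)).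
  - apply: filterS sx => yy /andP[s0 s1] _.
    rewrite ger0_norm// divr_ge0 ?sqr_ge0// mulr_ge0 ?ltW//.
    by rewrite subr_gt0.
(* The right-hand integrand goes through a chosen projection at each prompt and is not known to be
   measurable; only the left one is. *)
have N_le : (\int[nu]_x N x <= \int[nu]_x
    ('N[embedded_law2 phi mu x]_(2%:E)
       [EFin \o score_residual phi q mu x] ^+ 2))%E.
  apply: ae_ge0_le_integral_nonmeasurable => //.
    by move=> x; rewrite sqre_ge0.
  apply: filterS2 hq hq01 => x qx sx.
  exact: (residual_energy_le u phi q mu hn x qx sx).
have main : (\int[nu]_x L x <=
    \int[nu]_x H x + \int[nu]_x AC x + (1 / 8)%:E * \int[nu]_x N x)%E.
  have HAC0 x : (0 <= H x + AC x)%E by exact: adde_ge0.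
  have N80 x : (0 <= (1 / 8)%:E * N x)%E by exact: mule_ge0.
  have mHAC : measurable_fun [set: X] (fun x => H x + AC x)%E.
    exact: emeasurable_funD.
  have mN8 : measurable_fun [set: X] (fun x => (1 / 8)%:E * N x)%E.
    exact: emeasurable_funM.
  rewrite -ge0_integralZl// -ge0_integralD// -ge0_integralD//.
  apply: ae_ge0_le_integral => //.
  - by move=> x _; exact: adde_ge0.
  - exact: emeasurable_funD.
  apply: filterS2 hq hq01 => x qx sx _.
  exact: (prompt_loss_le u phi q mu hn hmu x qx sx).
rewrite leeBlDr//; apply: (le_trans main).
rewrite ACE.
apply: (@le_trans _ _ (\int[nu]_x H x + (\int[nu]_x C x + (1 / 8)%:E * \int[nu]_x
    ('N[embedded_law2 phi mu x]_(2%:E)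
       [EFin \o score_residual phi q mu x] ^+ 2)))%E).
  by rewrite -addeA leeD2l// leeD2l// lee_wpmul2l.
(* The slack [eps] is positive and only enlarges the right-hand side. *)
rewrite addeC leeD2r//.
by rewrite leeDl// lee_fin ltW.
Qed.
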